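(* Under rETH, there are constants $\bar\epsilon>0$ and $\alpha>1$ such that for any $0<\delta<1$ there is no (randomized) $\alpha$-approximation algorithm for $d$-dimensional Euclidean $k$-supplier running in time $O^*\!\left(2^{2^{\bar\epsilon\cdot\delta\cdot d}\cdot k^{1-\delta}}\right)$.
   Context: Euclidean $k$-supplier in $\mathbb R^d$: given finite sets $\mathcal C,\mathcal F\subseteq\mathbb R^d$ and an integer $k>0$, find $F\subseteq\mathcal F$ with $|F|=k$ minimizing $\max_{p\in\mathcal C}\min_{i\in F}\|p-i\|$. An $\alpha$-approximation algorithm outputs a feasible solution of cost at most $\alpha$ times the optimum. $O^*(\cdot)$ suppresses factors polynomial in the input size. The randomized Exponential Time Hypothesis (rETH) states that there is a constant $c>0$ such that no randomized algorithm decides 3-SAT on $n$ variables in time $O^*(2^{cn})$ with two-sided error probability at most $1/3$. *)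

(* Defs.v *)
From mathcomp Require Import all_boot all_order all_algebra.
From mathcomp Require Import all_classical reals ereal exp.

Set Implicit Arguments.
Unset Strict Implicit.
Unset Printing Implicit Defensive.

Import Order.TTheory GRing.Theory Num.Theory.
Local Open Scope ring_scope.

(* Model of computation: Jones' WHILE language over binary trees, extended with
   coin flips.  Every assignment, flip and test costs one step; this is
   legitimate because cons, head and tail are constant-time pointer operations
   (trees may be shared), the only test is "is this tree a leaf?", and a fixed
   program contains only expressions of constant size.  The model is
   polynomially equivalent to multitape Turing machines, which it simulates
   with constant-factor overhead. *)

Inductive tree : Type := Leaf | Cons of tree & tree.

Fixpoint tsize (t : tree) : nat :=
  if t is Cons l r then (tsize l + tsize r).+1 else 1%N.

Definition thd (t : tree) : tree := if t is Cons l _ then l else Leaf.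
Definition ttl (t : tree) : tree := if t is Cons _ r then r else Leaf.
Definition truthy (t : tree) : bool := if t is Cons _ _ then true else false.

Definition enc_bool (b : bool) : tree := if b then Cons Leaf Leaf else Leaf.

Inductive expr : Type :=
  | ELeaf
  | EVar of nat
  | ECons of expr & expr
  | EHd of expr
  | ETl of expr.

Inductive cmd : Type :=
  | CSkip
  | CAssign of nat & expr
  | CFlip of nat
  | CSeq of cmd & cmd
  | CIf of expr & cmd & cmd
  | CWhile of expr & cmd.

Definition store := nat -> tree.

Definition upd (s : store) (x : nat) (t : tree) : store :=
  fun y => if y == x then t else s y.

Fixpoint eval (s : store) (e : expr) : tree :=
  match e with
  | ELeaf => Leaf
  | EVar x => s x
  | ECons e1 e2 => Cons (eval s e1) (eval s e2)
  | EHd e1 => thd (eval s e1)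
  | ETl e1 => ttl (eval s e1)
  end.

(* [exec c s w s' w' t]: started in store [s] with unread coin tosses [w], the
   program [c] halts after [t] steps in store [s'] with unread tosses [w'].
   A flip is stuck once the supplied tosses are exhausted. *)
Inductive exec : cmd -> store -> seq bool -> store -> seq bool -> nat -> Prop :=
  | XSkip s w : exec CSkip s w s w 1
  | XAssign x e s w : exec (CAssign x e) s w (upd s x (eval s e)) w 1
  | XFlip x b s w : exec (CFlip x) s (b :: w) (upd s x (enc_bool b)) w 1
  | XSeq c1 c2 s w s1 w1 t1 s2 w2 t2 :
      exec c1 s w s1 w1 t1 -> exec c2 s1 w1 s2 w2 t2 ->
      exec (CSeq c1 c2) s w s2 w2 (t1 + t2)
  | XIfT e c1 c2 s w s' w' t :
      truthy (eval s e) -> exec c1 s w s' w' t ->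
      exec (CIf e c1 c2) s w s' w' t.+1
  | XIfF e c1 c2 s w s' w' t :
      ~~ truthy (eval s e) -> exec c2 s w s' w' t ->
      exec (CIf e c1 c2) s w s' w' t.+1
  | XWhileF e c s w :
      ~~ truthy (eval s e) -> exec (CWhile e c) s w s w 1
  | XWhileT e c s w s1 w1 t1 s2 w2 t2 :
      truthy (eval s e) -> exec c s w s1 w1 t1 ->
      exec (CWhile e c) s1 w1 s2 w2 t2 ->
      exec (CWhile e c) s w s2 w2 (t1 + t2).+1.

Definition init (x : tree) : store := fun i => if i == 0%N then x else Leaf.

(* Input and output are held in variable 0. *)
Definition outputs (A : cmd) (x : tree) (w : seq bool) (T : nat) (y : tree) :=
  exists s w' t, [/\ exec A (init x) w s w' t, (t <= T)%N & s 0%N = y].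

(* As each flip costs a step, T tosses suffice for any run of at most T steps. *)
Definition halts_within (A : cmd) (x : tree) (T : nat) : Prop :=
  forall w : T.-tuple bool, exists y, outputs A x w T y.

Definition prob (R : realType) (A : cmd) (x : tree) (T : nat)
    (good : tree -> Prop) : R :=
  #|[set w : T.-tuple bool | `[< exists2 y, outputs A x w T y & good y >]]|%:R
  / 2 ^+ T.

(* [solves enc good f A]: on every input [i], [A] halts for all coin tosses
   within O*(f i) steps, and its output is [good] for [i] with probability at
   least 2/3. *)
Definition solves (R : realType) (I : Type) (enc : I -> tree)
    (good : I -> tree -> Prop) (f : I -> R) (A : cmd) : Prop :=
  exists p : {poly nat}, forall i : I, exists T : nat,
    [/\ T%:R <= (p.[tsize (enc i)])%:R * f i,
        halts_within A (enc i) T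
      & 2 / 3 <= prob R A (enc i) T (good i)].

Definition enc_seq (X : Type) (enc : X -> tree) (s : seq X) : tree :=
  foldr (fun x t => Cons (enc x) t) Leaf s.

(* Unary is used only where it changes the input size polynomially: for the
   dimension and the budget, which are bounded by the size of the facility list,
   and for the number n of variables and their indices, where moreover a poly(n)
   factor is absorbed by 2^(c n).  Coordinates are written in binary. *)
Definition enc_unary (n : nat) : tree := iter n (Cons Leaf) Leaf.

Fixpoint enc_pos (p : BinNums.positive) : tree :=
  match p with
  | BinNums.xH => Leaf
  | BinNums.xO q => Cons (enc_bool false) (enc_pos q)
  | BinNums.xI q => Cons (enc_bool true) (enc_pos q)
  end.

Definition enc_binary (n : nat) : tree :=
  match bin_of_nat n with
  | BinNums.N0 => Leaf
  | BinNums.Npos p => Cons Leaf (enc_pos p)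
  end.

Definition enc_int (z : int) : tree :=
  Cons (enc_bool (z < 0)) (enc_binary `|z|%N).

Definition enc_rat (q : rat) : tree :=
  Cons (enc_int (numq q)) (enc_int (denq q)).

Definition enc_point (d : nat) (v : 'rV[rat]_d) : tree :=
  enc_seq enc_rat [seq v 0 i | i <- enum 'I_d].

(* The literal (x, b) is true under a when a x = b; a clause may repeat a
   literal, so clauses with fewer than three literals are included. *)
Record cnf3 := CNF3 {
  nvars : nat;
  clauses : seq (3.-tuple ('I_nvars * bool))
}.

Definition satisfiable (phi : cnf3) : bool :=
  [exists a : {ffun 'I_(nvars phi) -> bool},
    all (fun cl : 3.-tuple _ => has (fun l => a l.1 == l.2) cl) (clauses phi)].

Definition enc_literal (n : nat) (l : 'I_n * bool) : tree :=
  Cons (enc_unary l.1) (enc_bool l.2).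

Definition enc_cnf3 (phi : cnf3) : tree :=
  Cons (enc_unary (nvars phi))
    (enc_seq (fun cl : 3.-tuple _ => enc_seq (@enc_literal _) cl) (clauses phi)).

Definition decides_sat (phi : cnf3) (y : tree) : Prop :=
  truthy y = satisfiable phi.

Definition rETH (R : realType) : Prop :=
  exists c : R, 0 < c /\
    ~ exists A : cmd,
        solves enc_cnf3 decides_sat
          (fun phi => 2 `^ (c * (nvars phi)%:R)) A.

(* Finite sets are given as duplicate-free lists, in arbitrary order; points
   have rational coordinates so that instances are finite objects. *)
Record supplier := Supplier {
  sdim : nat;
  clients : seq 'rV[rat]_sdim;
  facilities : seq 'rV[rat]_sdim;
  budget : nat;
  _ : uniq clients;
  _ : uniq facilities;
  _ : (0 < budget <= size facilities)%N
}.

Definition enc_supplier (I : supplier) : tree :=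
  Cons (enc_unary (sdim I))
    (Cons (enc_seq (@enc_point _) (clients I))
       (Cons (enc_seq (@enc_point _) (facilities I))
          (enc_unary (budget I)))).

Definition feasible (I : supplier) (S : seq 'rV[rat]_(sdim I)) : Prop :=
  [/\ uniq S, {subset S <= facilities I} & size S = budget I].

Definition edist (R : realType) (d : nat) (p q : 'rV[rat]_d) : R :=
  Num.sqrt (\sum_(i < d) (ratr (p 0 i) - ratr (q 0 i)) ^+ 2).

(* The cost is 0 if there are no clients. *)
Definition cost (R : realType) (I : supplier) (S : seq 'rV[rat]_(sdim I)) :
    \bar R :=
  \big[maxe/0%E]_(p <- clients I) \big[mine/+oo%E]_(q <- S) (edist R p q)%:E.

Definition opt (R : realType) (I : supplier) : \bar R :=
  ereal_inf [set cost R S | S in [set S | @feasible I S]]%classic.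

Definition approx_solution (R : realType) (alpha : R) (I : supplier) (y : tree) :
    Prop :=
  exists S : seq 'rV[rat]_(sdim I),
    [/\ y = enc_seq (@enc_point _) S, feasible S
      & (cost R S <= alpha%:E * opt R I)%E].

(* Main.v *)
(* The reduction from 3-SAT opens one facility per variable (plus a dummy one).
   A greedy choice among all binary words of length N = O(log n) yields, for each
   of the 2(n+1) literals, a word agreeing with every other one in a proportion
   of positions between 3/7 and 4/7: with entries +1 and -1, the words of the
   literals are nearly orthogonal vectors.  The facility of a literal is a large
   multiple of its vector, and the client of a clause is the sum of the vectors
   of its three literals; it is closer, by a constant factor, to the facilities
   of its own literals than to all others.  The tautologies (x \/ ~x \/ ~x), as
   additional clients, force the k = n+1 open facilities to contain exactly one
   literal of each variable.  Thus an approximate solution of the instance of a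
   satisfiable formula reads as a satisfying assignment, which is checked before
   answering, and one run takes 2^(2^(eps delta d) k^(1-delta)) =
   2^O(n^(1-delta/2)) = 2^o(n) steps.  An additional coordinate, too small to
   affect the gap, makes the points distinct and names the literals. *)

Require Import Defs.
From mathcomp Require Import all_boot all_order all_algebra.
From mathcomp Require Import all_classical reals ereal exp.
From mathcomp Require Import zify ring lra.

Set Implicit Arguments.
Unset Strict Implicit.
Unset Printing Implicit Defensive.

Import Order.TTheory GRing.Theory Num.Theory.
Local Open Scope ring_scope.

(** * Polynomial-time functions *)

Local Open Scope nat_scope.

(** The logarithmic word length matters twice: it turns 2^(eps delta d) into O(n^(delta/2)), and it
    keeps the list of all words polynomially long, so that the greedy choice can be carried out by
    the reduction itself. As n^(1-delta/2) is eventually below c n for every c > 0, [eps] and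
    [alpha] do not depend on the constant of [rETH]. The gap comes from counting agreements in units
    of 1/7 of the word length: with the three words of a clause, one of its own literals agrees in
    at least 7 + 3 + 3 = 13 units in total, any other literal in at most 4 + 4 + 4 = 12. The dummy
    variable keeps the budget positive for a formula without variables. [rETH] speaks of concrete
    programs, so the reduction and the decoding have to be programs too; they are obtained from
    closure properties of a class of polynomial-time functions. A run of the approximation algorithm
    may output any tree, even one of exponential size, so decoding reads only a polynomial part of
    it. *)

Lemma leq_expn_base m n e : m <= n -> m ^ e <= n ^ e.
Proof. by case: e => // e le_mn; rewrite leq_exp2r. Qed.

(** The base is at least 2, so constants and sums are absorbed by the exponent, and one number [k]
    describes a polynomial bound. *)
Definition pbnd (X : Type) (m g : X -> nat) : Prop :=
  exists k, forall x, g x <= (m x + 2) ^ k.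

Lemma pbnd_le (X : Type) (m g h : X -> nat) :
  (forall x, g x <= h x) -> pbnd m h -> pbnd m g.
Proof. by move=> gh [k hk]; exists k => x; apply: leq_trans (gh x) (hk x). Qed.

Lemma pbnd_id (X : Type) (m : X -> nat) : pbnd m m.
Proof. by exists 1 => x; rewrite expn1 leq_addr. Qed.

Lemma pbnd_const (X : Type) (m : X -> nat) c : pbnd m (fun=> c).
Proof.
exists c => x; apply: leq_trans (ltnW (ltn_expl c (ltnSn 1))) _.
by apply: leq_expn_base; rewrite leq_addl.
Qed.

Lemma pbnd_mul (X : Type) (m g h : X -> nat) :
  pbnd m g -> pbnd m h -> pbnd m (fun x => g x * h x).
Proof.
by move=> [k gk] [j hj]; exists (k + j) => x; rewrite expnD leq_mul.
Qed.

Lemma pbnd_add (X : Type) (m g h : X -> nat) :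
  pbnd m g -> pbnd m h -> pbnd m (fun x => g x + h x).
Proof.
move=> [k gk] [j hj]; exists (k + j).+1 => x.
apply: leq_trans (leq_add (gk x) (hj x)) _.
rewrite expnS expnD; set a := (_ ^ k); set b := (_ ^ j).
have a0 : 0 < a by rewrite expn_gt0 addn2.
have b0 : 0 < b by rewrite expn_gt0 addn2.
by nia.
Qed.

Lemma pbnd_expr (X : Type) (m g : X -> nat) j :
  pbnd m g -> pbnd m (fun x => g x ^ j).
Proof.
move=> bg; elim: j => [|j IH]; first exact: (pbnd_const _ 1).
by apply: pbnd_le (pbnd_mul bg IH) => x; rewrite expnS.
Qed.

Lemma pbnd_trans (X : Type) (m g h : X -> nat) :
  pbnd m g -> pbnd g h -> pbnd m h.
Proof.
move=> bg [k hk]; apply: pbnd_le hk _.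
by apply: pbnd_expr; apply: pbnd_add bg _; exact: pbnd_const.
Qed.

Lemma pbnd_comp (X Y : Type) (m g : Y -> nat) (f : X -> Y) :
  pbnd m g -> pbnd (fun x => m (f x)) (fun x => g (f x)).
Proof. by move=> [k gk]; exists k => x; apply: gk. Qed.

(** Total correctness with a time bound. The unread tosses are the same before and after, so no flip
    is executed: these are the deterministic parts of the final algorithm. *)
Definition reaches (c : cmd) (s : store) w T (Q : store -> Prop) : Prop :=
  exists s' t, [/\ exec c s w s' w t, t <= T & Q s'].

Lemma reaches_weaken c s w T1 T2 (Q1 Q2 : store -> Prop) :
  reaches c s w T1 Q1 -> T1 <= T2 -> (forall s', Q1 s' -> Q2 s') ->
  reaches c s w T2 Q2.
Proof.
move=> [s' [t [e le_t q]]] le_T QQ; exists s', t; split=> //; last exact: QQ.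
exact: leq_trans le_t le_T.
Qed.

Lemma reaches_seq c1 c2 s w T1 T2 (Q1 Q2 : store -> Prop) :
  reaches c1 s w T1 Q1 -> (forall s1, Q1 s1 -> reaches c2 s1 w T2 Q2) ->
  reaches (CSeq c1 c2) s w (T1 + T2) Q2.
Proof.
move=> [s1 [t1 [e1 l1 /[swap] /[apply]]]] [s2 [t2 [e2 l2 q2]]].
exists s2, (t1 + t2); split=> //; first exact: XSeq e1 e2.
exact: leq_add.
Qed.

Lemma reaches_assign x e s w (Q : store -> Prop) :
  Q (upd s x (Defs.eval s e)) -> reaches (CAssign x e) s w 1 Q.
Proof. by move=> q; exists (upd s x (Defs.eval s e)), 1; split=> //; constructor. Qed.

Lemma reaches_if e c1 c2 s w T1 T2 (Q : store -> Prop) :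
  (truthy (Defs.eval s e) -> reaches c1 s w T1 Q) ->
  (~~ truthy (Defs.eval s e) -> reaches c2 s w T2 Q) ->
  reaches (CIf e c1 c2) s w (T1 + T2).+1 Q.
Proof.
case: (boolP (truthy (Defs.eval s e))) => he h1 h2.
  have [s' [t [e1 lt q]]] := h1 isT.
  exists s', t.+1; split=> //; first exact: XIfT.
  by rewrite ltnS (leq_trans lt) ?leq_addr.
have [s' [t [e1 lt q]]] := h2 isT.
exists s', t.+1; split=> //; first exact: XIfF.
by rewrite ltnS (leq_trans lt) ?leq_addl.
Qed.

Lemma upd_eq s x t : upd s x t x = t.
Proof. by rewrite /upd eqxx. Qed.

Lemma upd_neq s x y t : y != x -> upd s x t y = s y.
Proof. by rewrite /upd => /negPf->. Qed.

(* [csz] is the size against which a running time is measured.  Raw trees have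
   size 0: the output of an algorithm may be exponentially larger than its input
   (subtrees are shared), and only a bounded part of it may be inspected. *)
Record ctype := CType {
  csort :> Type;
  cenc : csort -> tree;
  csz : csort -> nat
}.
Arguments cenc {c} _.
Arguments csz {c} _.

Canonical tree_ct := @CType tree id (fun=> 0).
Canonical bool_ct := CType enc_bool (fun b => Defs.tsize (enc_bool b)).
Canonical nat_ct := CType enc_unary (fun n => n.*2.+1).
Canonical rat_ct := CType enc_rat (fun q => Defs.tsize (enc_rat q)).
Canonical cnf3_ct := CType enc_cnf3 (fun phi => Defs.tsize (enc_cnf3 phi)).
Canonical prod_ct (X Y : ctype) :=
  @CType (X * Y)%type (fun p => Defs.Cons (cenc p.1) (cenc p.2))
    (fun p => (csz p.1 + csz p.2).+1).
Canonical seq_ct (X : ctype) :=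
  @CType (seq X) (enc_seq cenc) (fun s => foldr (fun x n => (csz x + n).+1) 1 s).

Definition same_from N (s s' : store) := forall i, N <= i -> s' i = s i.

Lemma same_fromW N1 N2 s s' : N1 <= N2 -> same_from N1 s s' -> same_from N2 s s'.
Proof. by move=> le_N h i le_i; apply: h; apply: leq_trans le_i. Qed.

Lemma same_from_trans N s1 s2 s3 :
  same_from N s1 s2 -> same_from N s2 s3 -> same_from N s1 s3.
Proof. by move=> h1 h2 i le_i; rewrite h2 ?h1. Qed.

Lemma same_from_upd N s s' x t :
  x < N -> same_from N s s' -> same_from N s (upd s' x t).
Proof.
move=> lt_x h i le_i; rewrite upd_neq ?h //.
by apply: contraL le_i => /eqP->; rewrite -ltnNge.
Qed.

(** The program has to work in every store with the input in variable 0 and to preserve the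
    variables from [N] on. Hence programs compose without clearing variables, and values can be kept
    above [N]. The bound on the output size does not follow from the time bound, since pairing a
    tree with itself doubles its size in one step. *)
Definition ptime (X Y : ctype) (f : X -> Y) : Prop :=
  exists c N (T : X -> nat),
    [/\ pbnd csz T, pbnd csz (fun x => csz (f x)) &
      forall x s w, s 0 = cenc x ->
        reaches c s w (T x) (fun s' => s' 0 = cenc (f x) /\ same_from N s s')].

Lemma ptime_ext (X Y : ctype) (f g : X -> Y) : f =1 g -> ptime f -> ptime g.
Proof.
move=> fg [c [N [T [bT bf h]]]]; exists c, N, T; split=> //.
  by apply: pbnd_le bf => x; rewrite fg.
by move=> x s w /(h x s w); rewrite fg.
Qed.

Lemma ptime_size (X Y : ctype) (f : X -> Y) :
  ptime f -> pbnd csz (fun x => csz (f x)).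
Proof. by case=> c [N [T []]]. Qed.

Lemma ptime_expr (X Y : ctype) (f : X -> Y) (e : expr) :
  (forall x s, s 0 = cenc x -> Defs.eval s e = cenc (f x)) ->
  pbnd csz (fun x => csz (f x)) -> ptime f.
Proof.
move=> h bf; exists (CAssign 0 e), 1, (fun=> 1); split=> //.
  exact: pbnd_const.
move=> x s w s0; apply: reaches_assign; rewrite upd_eq; split; first exact: h.
exact: same_from_upd.
Qed.

Lemma ptime_id (X : ctype) : ptime (fun x : X => x).
Proof. by apply: (ptime_expr (e := EVar 0)) => //; apply: pbnd_id. Qed.

Fixpoint quote (t : tree) : expr :=
  if t is Defs.Cons l r then ECons (quote l) (quote r) else ELeaf.

Lemma eval_quote s t : Defs.eval s (quote t) = t.
Proof. by elim: t => //= l -> r ->. Qed.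

Lemma ptime_const (X Y : ctype) (y : Y) : ptime (fun _ : X => y).
Proof.
apply: (ptime_expr (e := quote (cenc y))) => [x s _|]; first exact: eval_quote.
exact: pbnd_const.
Qed.

Lemma ptime_comp (X Y Z : ctype) (g : Y -> Z) (f : X -> Y) :
  ptime g -> ptime f -> ptime (fun x => g (f x)).
Proof.
move=> [cg [Ng [Tg [bTg bg hg]]]] [cf [Nf [Tf [bTf bf hf]]]].
exists (CSeq cf cg), (maxn Nf Ng), (fun x => Tf x + Tg (f x)); split.
- apply: pbnd_add => //; apply: pbnd_trans bf _.
  exact: (pbnd_comp (m := csz)).
- by apply: pbnd_trans bf _; apply: (pbnd_comp (m := csz) (g := csz \o g)).
move=> x s w s0; apply: reaches_seq (hf x s w s0) _ => s1 [s10 sf].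
apply: reaches_weaken (hg (f x) s1 w s10) (leqnn _) _ => s2 [s20 sg].
split=> //; apply: same_from_trans (same_fromW _ sf) (same_fromW _ sg).
  exact: leq_maxl.
exact: leq_maxr.
Qed.

Lemma ptime_pair (X Y Z : ctype) (f : X -> Y) (g : X -> Z) :
  ptime f -> ptime g -> ptime (fun x => (f x, g x)).
Proof.
move=> [cf [Nf [Tf [bTf bf hf]]]] [cg [Ng [Tg [bTg bg hg]]]].
(* Out of reach of both programs, and different from 0: [N] keeps the input and [N.+1] the first
   result. *)
pose N := (maxn Nf Ng).+1.
have leNf : Nf <= N by rewrite leqW // leq_maxl.
have leNg : Ng <= N by rewrite leqW // leq_maxr.
exists (CSeq (CAssign N (EVar 0)) (CSeq cf (CSeq (CAssign N.+1 (EVar 0))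
  (CSeq (CAssign 0 (EVar N)) (CSeq cg
    (CAssign 0 (ECons (EVar N.+1) (EVar 0)))))))),
  N.+2, (fun x => 1 + (Tf x + (1 + (1 + (Tg x + 1))))); split.
- by do !(apply: pbnd_add; try exact: pbnd_const).
- apply: (@pbnd_le _ _ _ (fun x => csz (f x) + csz (g x) + 1)) => [x|].
    by rewrite addn1.
  by do !apply: pbnd_add => //; exact: pbnd_const.
move=> x s w s0.
apply: (reaches_seq (Q1 := fun s1 => s1 = upd s N (s 0))).
  exact: reaches_assign.
move=> s1 ->; apply: reaches_seq (hf x _ w _) _; first by rewrite upd_neq.
move=> s2 [s20 e2]; apply: (reaches_seq (Q1 := fun s3 => s3 = upd s2 N.+1 (s2 0))).
  exact: reaches_assign.
move=> s3 ->.
apply: (reaches_seq (Q1 := fun s4 => s4 = upd (upd s2 N.+1 (s2 0)) 0 (cenc x))).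
  apply: reaches_assign; congr upd.
  by rewrite /= upd_neq ?neq_ltn ?ltnSn // e2 // upd_eq.
move=> s4 ->; apply: reaches_seq (hg x _ w _) _; first by rewrite upd_eq.
move=> s5 [s50 e5]; apply: reaches_assign; rewrite upd_eq /=; split.
  by rewrite s50 e5 ?(leq_trans leNg) // upd_neq // upd_eq s20.
apply: same_from_upd => // i le_i.
have neq j : j < N.+2 -> i != j.
  by move=> lt_j; rewrite neq_ltn (leq_trans lt_j) ?orbT.
have le_N : N <= i by apply: leq_trans le_i; rewrite leqW.
rewrite e5 ?(leq_trans leNg) // upd_neq ?neq // upd_neq ?neq //.
by rewrite e2 ?(leq_trans leNf) // upd_neq ?neq.
Qed.

Lemma ptime_comp2 (X Y Z W : ctype) (h : Y -> Z -> W) (f : X -> Y) (g : X -> Z) :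
  ptime (fun p : Y * Z => h p.1 p.2) -> ptime f -> ptime g ->
  ptime (fun x => h (f x) (g x)).
Proof.
move=> hh hf hg.
exact: (ptime_comp (g := fun p : Y * Z => h p.1 p.2) hh (ptime_pair hf hg)).
Qed.

Lemma ptime_fst (X Y Z : ctype) (f : X -> Y * Z) :
  ptime f -> ptime (fun x => (f x).1).
Proof.
apply: (ptime_comp (g := fun p : Y * Z => p.1)).
apply: (ptime_expr (e := EHd (EVar 0))) => [x s /= ->|] //.
by apply: pbnd_le (pbnd_id _) => p /=; rewrite leqW ?leq_addr.
Qed.

Lemma ptime_snd (X Y Z : ctype) (f : X -> Y * Z) :
  ptime f -> ptime (fun x => (f x).2).
Proof.
apply: (ptime_comp (g := fun p : Y * Z => p.2)).
apply: (ptime_expr (e := ETl (EVar 0))) => [x s /= ->|] //.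
by apply: pbnd_le (pbnd_id _) => p /=; rewrite leqW ?leq_addl.
Qed.

Lemma ptime_if (X Y : ctype) (b : X -> bool) (f g : X -> Y) :
  ptime b -> ptime f -> ptime g -> ptime (fun x => if b x then f x else g x).
Proof.
move=> [cb [Nb [Tb [bTb _ hb]]]] [cf [Nf [Tf [bTf bf hf]]]].
move=> [cg [Ng [Tg [bTg bg hg]]]].
pose N := (maxn Nb (maxn Nf Ng)).+1; pose M := N.+1.
exists (CSeq (CAssign N (EVar 0)) (CSeq cb (CSeq (CAssign M (EVar 0))
  (CSeq (CAssign 0 (EVar N)) (CIf (EVar M) cf cg))))),
  M.+1, (fun x => 1 + (Tb x + (1 + (1 + (Tf x + Tg x).+1)))); split.
- apply: (@pbnd_le _ _ _ (fun x => Tb x + (Tf x + Tg x) + 4)) => [x|].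
    by lia.
  by do !apply: pbnd_add => //; exact: pbnd_const.
- apply: (@pbnd_le _ _ _ (fun x => csz (f x) + csz (g x))) => [x|].
    by case: (b x); rewrite ?leq_addl ?leq_addr.
  exact: pbnd_add.
move=> x s w s0; have [leb lef leg] : [/\ Nb <= N, Nf <= M.+1 & Ng <= M.+1].
  by rewrite /M /N; split; lia.
apply: (reaches_seq (Q1 := fun s1 => s1 = upd s N (s 0))).
  exact: reaches_assign.
move=> s1 ->; apply: reaches_seq (hb x _ w _) _; first by rewrite upd_neq.
move=> s2 [s20 e2]; apply: (reaches_seq (Q1 := fun s3 => s3 = upd s2 M (s2 0))).
  exact: reaches_assign.
move=> s3 ->.
pose s4 := upd (upd s2 M (s2 0)) 0 (cenc x).
apply: (reaches_seq (Q1 := fun s' => s' = s4)).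
  apply: reaches_assign; congr upd.
  by rewrite /= upd_neq ?neq_ltn ?ltnSn // e2 // upd_eq.
have s4s : same_from M.+1 s s4.
  apply: same_from_upd => //; apply: same_from_upd => // i le_i.
  by rewrite e2 ?upd_neq //; move: le_i; rewrite /M; clear; lia.
have -> : (fun s' => s' 0 = cenc (if b x then f x else g x) /\ same_from M.+1 s s')
   = (fun s' => s' 0 = (if b x then cenc (f x) else cenc (g x)) /\ same_from M.+1 s s').
  by case: (b x).
move=> _ ->; have s4M : Defs.eval s4 (EVar M) = enc_bool (b x).
  by rewrite /s4 /= upd_neq // upd_eq s20.
apply: reaches_if; rewrite s4M; case: (b x) => // _.
  apply: reaches_weaken (hf x s4 w _) (leqnn _) _ => // s5 [-> h5]; split=> //.
  by apply: same_from_trans s4s _; apply: same_fromW h5.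
apply: reaches_weaken (hg x s4 w _) (leqnn _) _ => // s5 [-> h5]; split=> //.
by apply: same_from_trans s4s _; apply: same_fromW h5.
Qed.

Lemma csz_seq_gt0 (X : ctype) (s : seq X) : 0 < csz s.
Proof. by case: s. Qed.

Lemma csz_catl (X : ctype) (s1 s2 : seq X) : csz s1 <= csz (s1 ++ s2).
Proof. by elim: s1 => /= [|x s1]; [exact: csz_seq_gt0 | lia]. Qed.

Lemma size_csz (X : ctype) (s : seq X) : size s < csz s.
Proof. by elim: s => //= x s; lia. Qed.

Lemma csz_mid (X : ctype) (s1 : seq X) x s2 : csz x < csz (s1 ++ x :: s2).
Proof.
elim: s1 => [|y s1 IH] /=; first by rewrite ltnS leq_addr.
by apply: leq_trans IH _; rewrite leqW // leq_addl.
Qed.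

(* Only prefixes of the list matter for the size bound, since these are the
   intermediate values of the loop. *)
Lemma ptime_foldl (X A B : ctype) (F : X -> B -> A -> B) (b0 : X -> B)
    (l : X -> seq A) :
  ptime (fun p : X * B * A => F p.1.1 p.1.2 p.2) -> ptime b0 -> ptime l ->
  (exists2 S : X -> nat, pbnd csz S &
    forall x l1 l2, l x = l1 ++ l2 -> csz (foldl (F x) (b0 x) l1) <= S x) ->
  ptime (fun x => foldl (F x) (b0 x) (l x)).
Proof.
move=> [cF [NF [TF [[kF bTF] _ hF]]]] [cb [Nb [Tb [bTb bb hb]]]].
move=> [cl [Nl [Tl [bTl bl hl]]]] [S bS hS].
pose N := (maxn NF (maxn Nb Nl)).+1.
have [leF leb lel] : [/\ NF <= N, Nb <= N & Nl <= N] by rewrite /N; split; lia.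
pose body := CSeq (CAssign 0 (ECons (ECons (EVar N) (EVar N.+1)) (EHd (EVar N.+2))))
  (CSeq cF (CSeq (CAssign N.+1 (EVar 0)) (CAssign N.+2 (ETl (EVar N.+2))))).
(* Bounds one call of the program of [F]: the accumulator has size at most [S x], the entry at most
   [csz (l x)], and 4 covers two pairings and the 2 of [pbnd]. *)
pose U x := (csz x + S x + csz (l x) + 4) ^ kF.
exists (CSeq (CAssign N (EVar 0)) (CSeq cb (CSeq (CAssign N.+1 (EVar 0))
  (CSeq (CAssign 0 (EVar N)) (CSeq cl (CSeq (CAssign N.+2 (EVar 0))
  (CSeq (CWhile (EVar N.+2) body) (CAssign 0 (EVar N.+1))))))))).
exists N.+3.
exists (fun x => 1 + (Tb x + (1 + (1 + (Tl x +
  (1 + ((csz (l x) * (U x + 4)).+1 + 1))))))).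
split.
- apply: (@pbnd_le _ _ _
    (fun x => Tb x + Tl x + csz (l x) * (U x + 4) + 6)) => [x|]; first by lia.
  do !apply: pbnd_add => //; try exact: pbnd_const.
  apply: pbnd_mul => //; apply: pbnd_add; last exact: pbnd_const.
  apply: pbnd_expr; do !apply: pbnd_add => //; try exact: pbnd_const.
  exact: pbnd_id.
- by apply: pbnd_le bS => x; apply: (hS x _ [::]); rewrite cats0.
move=> x s w s0.
apply: (reaches_seq (Q1 := fun s1 => s1 = upd s N (s 0))).
  exact: reaches_assign.
move=> s1 ->; apply: reaches_seq (hb x _ w _) _; first by rewrite upd_neq.
move=> s2 [s20 e2]; apply: (reaches_seq (Q1 := fun s3 => s3 = upd s2 N.+1 (s2 0))).
  exact: reaches_assign.
move=> s3 ->.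
apply: (reaches_seq (Q1 := fun s4 => s4 = upd (upd s2 N.+1 (s2 0)) 0 (cenc x))).
  apply: reaches_assign; congr upd.
  by rewrite /= upd_neq ?neq_ltn ?ltnSn // e2 // upd_eq.
move=> s4 ->; apply: reaches_seq (hl x _ w _) _; first by rewrite upd_eq.
move=> s5 [s50 e5].
apply: (reaches_seq (Q1 := fun s6 => s6 = upd s5 N.+2 (s5 0))).
  exact: reaches_assign.
move=> s6 ->.
pose inv l1 l2 s' := [/\ s' N = cenc x, s' N.+1 = cenc (foldl (F x) (b0 x) l1),
  s' N.+2 = cenc (l2 : seq A) & same_from N.+3 s s'].
have loop l2 : forall l1 s', l x = l1 ++ l2 -> inv l1 l2 s' ->
    reaches (CWhile (EVar N.+2) body) s' w (csz l2 * (U x + 4)).+1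
      (inv (l x) [::]).
  elim: l2 => [|a l2 IH] l1 s' El [iN iN1 iN2 iS].
    rewrite cats0 in El; exists s', 1; split=> //; last by rewrite El.
    by apply: XWhileF; rewrite /= iN2.
  have hbody : reaches body s' w (1 + (U x + (1 + 1))) (inv (rcons l1 a) l2).
    apply: (reaches_seq (Q1 := fun r1 => r1 = upd s' 0
      (cenc (x, foldl (F x) (b0 x) l1, a)))).
      by apply: reaches_assign; rewrite /= iN iN1 iN2.
    move=> _ ->; apply: (@reaches_seq _ _ _ _ _ _
      (fun r1 => r1 0 = cenc (foldl (F x) (b0 x) (rcons l1 a))
        /\ same_from N (upd s' 0 (cenc (x, foldl (F x) (b0 x) l1, a))) r1)).
      apply: reaches_weaken (hF (x, foldl (F x) (b0 x) l1, a) _ w _) _ _.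
      - by rewrite upd_eq.
      - apply: leq_trans (bTF _) _; apply: leq_expn_base; rewrite /=.
        have h1 := hS x l1 _ El; have h2 := csz_mid l1 a l2; move: h1 h2.
        by rewrite -El /=; clear; lia.
      - by move=> r1 [-> hs1]; rewrite foldl_rcons; split=> //; apply: same_fromW hs1.
    move=> r' [r0 er].
    apply: (reaches_seq (Q1 := fun r2 => r2 = upd r' N.+1 (r' 0))).
      exact: reaches_assign.
    move=> _ ->; apply: reaches_assign; rewrite /inv.
    have e i : 0 < i -> N <= i -> r' i = s' i.
      by move=> i0 le_i; rewrite er // upd_neq // -lt0n.
    split.
    - by rewrite !upd_neq ?e ?neq_ltn ?ltnSn ?ltnS ?leqnSn.
    - by rewrite upd_neq ?upd_eq // neq_ltn ltnSn.
    - by rewrite upd_eq /= upd_neq ?e ?iN2 // ?neq_ltn ?ltnSn ?orbT //; clear; lia.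
    - apply: same_from_upd => //; apply: same_from_upd => // i le_i.
      by rewrite e ?iS //; move: le_i; clear; lia.
  have [r1 [t1 [x1 le1 i1]]] := hbody.
  have [|r2 [t2 [x2 le2 i2]]] := IH (rcons l1 a) r1 _ i1; first by rewrite cat_rcons.
  exists r2, (t1 + t2).+1; split=> //; first by apply: XWhileT x1 x2; rewrite /= iN2.
  (* A round costs one test and at most [U x + 3] further steps, and the size of the unread list
     drops by at least 1. *)
  move: le1 le2 => /=; set u := U x; set z := foldr _ _ _; nia.
apply: reaches_seq.
  have e i : N <= i -> i != 0 -> i != N.+1 -> s5 i = s2 i.
    by move=> le_i i0 iN1; rewrite e5 ?(leq_trans lel) // !upd_neq.
  apply: (loop _ [::]) => //; split.
  - by rewrite upd_neq ?e ?neq_ltn ?ltnSn ?ltnS ?leqnSn // e2 // upd_eq.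
  - rewrite upd_neq ?neq_ltn ?ltnSn // e5 ?(leq_trans lel) //.
    by rewrite upd_neq // upd_eq.
  - by rewrite upd_eq s50.
  - apply: same_from_upd => // i le_i; rewrite e; try lia.
    by rewrite e2 ?upd_neq //; lia.
move=> s' [_ sN1 _ ss]; apply: reaches_assign; rewrite upd_eq; split=> //.
exact: same_from_upd.
Qed.

Lemma csz_pairE (X Y : ctype) (x : X) (y : Y) : csz (x, y) = (csz x + csz y).+1.
Proof. by []. Qed.

Lemma csz_consE (X : ctype) (x : X) s : csz (x :: s) = (csz x + csz s).+1.
Proof. by []. Qed.

Lemma csz_nilE (X : ctype) : csz ([::] : seq X) = 1.
Proof. by []. Qed.

Ltac pbnd_sum :=
  repeat first [assumption | exact: pbnd_const | exact: pbnd_id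
               | apply: pbnd_mul | apply: pbnd_add].

(** With this encoding a list of n units and the unary number n are the same tree and have the same
    size, so loops over lists yield loops over numbers. *)
Canonical unit_ct := CType (fun _ : unit => Leaf) (fun=> 1).

Lemma reaches_assign0 e s w :
  reaches (CAssign 0 e) s w 1 (fun s' => s' 0 = Defs.eval s e /\ same_from 1 s s').
Proof.
by apply: reaches_assign; rewrite upd_eq; split=> //; apply: same_from_upd.
Qed.

(** A change of type that preserves the tree is free. This is used to read a number as a list of
    units, a pair as a nonempty list, and a formula as lists of indexed literals. *)
Lemma ptime_cast (X Y Z : ctype) (g : Y -> Z) (f : X -> Y) :
  (forall y, cenc (g y) = cenc y) -> (forall y, csz (g y) <= csz y) ->
  ptime f -> ptime (fun x => g (f x)).
Proof.
move=> eg lg; apply: ptime_comp; apply: (ptime_expr (e := EVar 0)).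
  by move=> y s /= ->.
exact: pbnd_le (pbnd_id _).
Qed.

(** * Polynomial-time operations on lists and unary numbers *)

Lemma ptime_cons (X A : ctype) (f : X -> A) (g : X -> seq A) :
  ptime f -> ptime g -> ptime (fun x => f x :: g x).
Proof.
move=> hf hg; apply: (ptime_cast (g := fun p : A * seq A => p.1 :: p.2)
  (f := fun x => (f x, g x))) => //.
exact: ptime_pair.
Qed.

Lemma ptime_behead (X A : ctype) (f : X -> seq A) :
  ptime f -> ptime (fun x => behead (f x)).
Proof.
apply: (ptime_comp (g := @behead A)); apply: (ptime_expr (e := ETl (EVar 0))).
  by move=> [|a l] s /= ->.
by apply: pbnd_le (pbnd_id _) => -[|a l] //=; rewrite leqW // leq_addl.
Qed.

Lemma ptime_head (X A : ctype) (a0 : A) (f : X -> seq A) :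
  ptime f -> ptime (fun x => head a0 (f x)).
Proof.
apply: (ptime_comp (g := head a0)).
exists (CIf (EVar 0) (CAssign 0 (EHd (EVar 0))) (CAssign 0 (quote (cenc a0)))).
exists 1, (fun=> 3); split; first exact: pbnd_const.
- apply: (@pbnd_le _ _ _ (fun l => csz l + csz a0)) => [[|a l] /=|]; try lia.
  by apply: pbnd_add; [exact: pbnd_id | exact: pbnd_const].
move=> l s w s0; apply: (@reaches_if _ _ _ _ _ 1 1); rewrite /= s0 => hl.
  apply: (reaches_weaken (reaches_assign0 _ _ _)) => // s' [-> hs].
  by case: l s0 hl => //= a l ->.
apply: (reaches_weaken (reaches_assign0 _ _ _)) => // s' [-> hs].
by rewrite eval_quote; case: l s0 hl.
Qed.

Lemma ptime_truthy (X Y : ctype) (b : Y -> bool) (f : X -> Y) :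
  (forall y, truthy (cenc y) = b y) -> ptime f -> ptime (fun x => b (f x)).
Proof.
move=> hb; apply: ptime_comp.
exists (CIf (EVar 0) (CAssign 0 (quote (enc_bool true))) (CAssign 0 ELeaf)).
exists 1, (fun=> 3); split; first exact: pbnd_const.
- by apply: (@pbnd_le _ _ _ (fun=> 3)) => [y|]; [case: (b y) | exact: pbnd_const].
move=> y s w s0; apply: (@reaches_if _ _ _ _ _ 1 1); rewrite /= s0 hb.
  by move=> ->; apply: reaches_assign0.
by move=> /negPf->; apply: reaches_assign0.
Qed.

Lemma ptime_nonempty (X A : ctype) (f : X -> seq A) :
  ptime f -> ptime (fun x => ~~ nilp (f x)).
Proof. by apply: (ptime_truthy (b := fun l => ~~ nilp l)) => -[]. Qed.

Lemma ptime_succ (X : ctype) (f : X -> nat) : ptime f -> ptime (fun x => (f x).+1).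
Proof.
apply: (ptime_comp (g := succn)); apply: (ptime_expr (e := ECons ELeaf (EVar 0))).
  by move=> n s /= ->.
apply: (@pbnd_le _ _ _ (fun n : nat => csz n + 2)) => [n /=|]; first by lia.
by apply: pbnd_add; [exact: pbnd_id | exact: pbnd_const].
Qed.

Lemma ptime_pred (X : ctype) (f : X -> nat) : ptime f -> ptime (fun x => (f x).-1).
Proof.
apply: (ptime_comp (g := predn)); apply: (ptime_expr (e := ETl (EVar 0))).
  by move=> [|n] s /= ->.
by apply: pbnd_le (pbnd_id _) => n /=; lia.
Qed.

Lemma ptime_gt0 (X : ctype) (f : X -> nat) : ptime f -> ptime (fun x => 0 < f x).
Proof. by apply: (ptime_truthy (b := fun n => 0 < n)) => -[]. Qed.

Lemma ptime_negb (X : ctype) (f : X -> bool) : ptime f -> ptime (fun x => ~~ f x).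
Proof.
move=> hf; apply: (ptime_ext (f := fun x => if f x then false else true)).
  by move=> x; case: (f x).
by apply: ptime_if => //; apply: ptime_const.
Qed.

Lemma ptime_andb (X : ctype) (f g : X -> bool) :
  ptime f -> ptime g -> ptime (fun x => f x && g x).
Proof.
move=> hf hg; apply: (ptime_ext (f := fun x => if f x then g x else false)) => //.
by apply: ptime_if => //; apply: ptime_const.
Qed.

Lemma ptime_orb (X : ctype) (f g : X -> bool) :
  ptime f -> ptime g -> ptime (fun x => f x || g x).
Proof.
move=> hf hg; apply: (ptime_ext (f := fun x => if f x then true else g x)) => //.
by apply: ptime_if => //; apply: ptime_const.
Qed.

Lemma ptime_eqb (X : ctype) (f g : X -> bool) :
  ptime f -> ptime g -> ptime (fun x => f x == g x).
Proof.
move=> hf hg; apply: (ptime_ext (f := fun x => if f x then g x else ~~ g x)).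
  by move=> x; case: (f x); case: (g x).
by apply: ptime_if => //; apply: ptime_negb.
Qed.

Lemma csz_nseq_unit n : csz (nseq n tt) = n.*2.+1.
Proof. by elim: n => //= n ->; rewrite doubleS. Qed.

Lemma ptime_iter (X B : ctype) (F : X -> B -> B) (b0 : X -> B) (n : X -> nat) :
  ptime (fun p : X * B => F p.1 p.2) -> ptime b0 -> ptime n ->
  (exists2 S : X -> nat, pbnd csz S &
    forall x i, i <= n x -> csz (iter i (F x) (b0 x)) <= S x) ->
  ptime (fun x => iter (n x) (F x) (b0 x)).
Proof.
move=> hF hb hn [S bS hS].
have E x i : foldl (fun b (_ : unit) => F x b) (b0 x) (nseq i tt)
    = iter i (F x) (b0 x).
  by elim: i (b0 x) => //= i IH b; rewrite IH -iterSr.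
apply: (ptime_ext (fun x => E x (n x))).
apply: (ptime_foldl (F := fun x b (_ : unit) => F x b)) => //.
- apply: (ptime_comp (g := fun p : X * B => F p.1 p.2)
    (f := fun p : X * B * unit => p.1)) => //.
  exact: ptime_fst (ptime_id _).
- apply: (ptime_cast (g := fun k => nseq k tt)) => // k; last by rewrite csz_nseq_unit.
  by elim: k => //= k ->.
exists S => // x l1 l2 El; rewrite -[l1]/l1.
have -> : l1 = nseq (size l1) tt by elim: l1 {El} => //= -[] l1 <-.
rewrite E; apply: hS.
by rewrite -(size_nseq (n x) tt) El size_cat leq_addr.
Qed.

Lemma ptime_iter_const (X Y : ctype) (F : Y -> Y) (f : X -> Y) k :
  ptime F -> ptime f -> ptime (fun x => iter k F (f x)).
Proof. by move=> hF hf; elim: k => //= k IH; apply: ptime_comp. Qed.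

Lemma csz_cat (A : ctype) (s1 s2 : seq A) : (csz (s1 ++ s2)).+1 = csz s1 + csz s2.
Proof. by elim: s1 => //= a s1; lia. Qed.

Lemma csz_rcons (A : ctype) (s : seq A) a : csz (rcons s a) = (csz s + csz a).+1.
Proof. by elim: s => /= [|b s ->]; lia. Qed.

Lemma csz_rev (A : ctype) (s : seq A) : csz (rev s) = csz s.
Proof. by elim: s => // a s IH; rewrite rev_cons csz_rcons IH /= addnC. Qed.

Lemma ptime_catrev (X A : ctype) (f g : X -> seq A) :
  ptime f -> ptime g -> ptime (fun x => catrev (f x) (g x)).
Proof.
move=> hf hg.
have E x l : foldl (fun l a => a :: l) (g x) l = catrev l (g x).
  by elim: l (g x) => //= a l IH l'; rewrite IH.
apply: (ptime_ext (fun x => E x (f x))).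
apply: ptime_foldl => //.
  apply: ptime_cons; first exact: ptime_snd (ptime_id _).
  exact: ptime_snd (ptime_fst (ptime_id _)).
exists (fun x => csz (f x) + csz (g x)).
  by apply: pbnd_add; exact: ptime_size.
move=> x l1 l2 El; rewrite E catrevE; have := csz_cat (rev l1) (g x).
by have := csz_catl l1 l2; rewrite csz_rev El; lia.
Qed.

Lemma ptime_rev (X A : ctype) (f : X -> seq A) :
  ptime f -> ptime (fun x => rev (f x)).
Proof.
move=> hf; apply: (ptime_ext (f := fun x => catrev (f x) [::])) => //.
by apply: ptime_catrev => //; apply: ptime_const.
Qed.

Lemma ptime_cat (X A : ctype) (f g : X -> seq A) :
  ptime f -> ptime g -> ptime (fun x => f x ++ g x).
Proof.
move=> hf hg; apply: (ptime_ext (f := fun x => catrev (rev (f x)) (g x))).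
  by move=> x; rewrite catrevE revK.
by apply: ptime_catrev => //; apply: ptime_rev.
Qed.

(** An entry is smaller than its list, so a single bound in [x] serves for all entries of [l x]. *)
Lemma csz_mem_bound (X A : ctype) (F : X -> A -> nat) (l : X -> seq A) :
  pbnd (@csz (prod_ct X A)) (fun p => F p.1 p.2) -> ptime l ->
  exists2 S : X -> nat, pbnd csz S &
    forall x l1 a l2, l x = l1 ++ a :: l2 -> F x a <= S x.
Proof.
move=> [k hk] /ptime_size hl.
exists (fun x => (csz x + csz (l x) + 3) ^ k).
  by apply: pbnd_expr; do !apply: pbnd_add => //; [exact: pbnd_id | exact: pbnd_const].
move=> x l1 a l2 El; apply: leq_trans (hk (x, a)) _; apply: leq_expn_base.
by have := csz_mid l1 a l2; rewrite -El /=; lia.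
Qed.

Lemma ptime_filter_map (X A B : ctype) (P : X -> A -> bool) (F : X -> A -> B)
    (l : X -> seq A) :
  ptime (fun p : X * A => P p.1 p.2) -> ptime (fun p : X * A => F p.1 p.2) ->
  ptime l -> ptime (fun x => [seq F x a | a <- l x & P x a]).
Proof.
move=> hP hF hl.
pose G x (acc : seq B) a := if P x a then F x a :: acc else acc.
have E x l1 : rev (foldl (G x) [::] l1) = [seq F x a | a <- l1 & P x a].
  elim/last_ind: l1 => // l1 a IH; rewrite foldl_rcons filter_rcons /G -/(G x).
  by case: (P x a); rewrite ?rev_cons ?map_rcons IH.
apply: (ptime_ext (fun x => E x (l x))); apply: ptime_rev.
have p1 : ptime (fun q : X * seq B * A => (q.1.1, q.2)).
  apply: ptime_pair; first exact: ptime_fst (ptime_fst (ptime_id _)).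
  exact: ptime_snd (ptime_id _).
have p2 : ptime (fun q : X * seq B * A => q.1.2).
  exact: ptime_snd (ptime_fst (ptime_id _)).
apply: (ptime_foldl (F := G)) => //; first 1 last.
- exact: ptime_const.
- have [S bS hS] := csz_mem_bound (F := fun x a => csz (F x a)) (ptime_size hF) hl.
  exists (fun x => csz (l x) * (S x).+1 + 1).
    apply: pbnd_add; last exact: pbnd_const.
    apply: pbnd_mul; first exact: ptime_size.
    apply: (@pbnd_le _ _ _ (fun x => S x + 1)) => [x|]; first by rewrite addn1.
    by apply: pbnd_add => //; exact: pbnd_const.
  move=> x l1 l2 El.
  have : csz (foldl (G x) [::] l1) <= size l1 * (S x).+1 + 1.
    elim/last_ind: l1 l2 El => // l1 a IH l2; rewrite cat_rcons => El.
    have := IH _ El; have := hS _ _ _ _ El.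
    rewrite foldl_rcons size_rcons; set acc := foldl _ _ _.
    rewrite /G mulSn; case: (P x a) => /=; set z := foldr _ _ acc; lia.
  move=> /leq_trans; apply; rewrite leq_add2r leq_mul2r; apply/orP; right.
  by rewrite El; apply: leq_trans (ltnW (size_csz _)) (csz_catl _ _).
apply: ptime_if => //.
  exact: (ptime_comp (g := fun p : X * A => P p.1 p.2) hP p1).
apply: ptime_cons => //.
exact: (ptime_comp (g := fun p : X * A => F p.1 p.2) hF p1).
Qed.

Lemma ptime_map (X A B : ctype) (F : X -> A -> B) (l : X -> seq A) :
  ptime (fun p : X * A => F p.1 p.2) -> ptime l ->
  ptime (fun x => [seq F x a | a <- l x]).
Proof.
move=> hF hl.
apply: (ptime_ext (f := fun x => [seq F x a | a <- l x & true])).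
  by move=> x; rewrite filter_predT.
by apply: (ptime_filter_map (P := fun _ _ => true)) => //; apply: ptime_const.
Qed.

Lemma ptime_filter (X A : ctype) (P : X -> A -> bool) (l : X -> seq A) :
  ptime (fun p : X * A => P p.1 p.2) -> ptime l ->
  ptime (fun x => [seq a <- l x | P x a]).
Proof.
move=> hP hl.
apply: (ptime_ext (f := fun x => [seq id a | a <- l x & P x a])).
  by move=> x; rewrite map_id.
by apply: (ptime_filter_map (F := fun _ a => a)) => //; apply: ptime_snd (ptime_id _).
Qed.

Lemma ptime_has (X A : ctype) (P : X -> A -> bool) (l : X -> seq A) :
  ptime (fun p : X * A => P p.1 p.2) -> ptime l ->
  ptime (fun x => has (P x) (l x)).
Proof.
move=> hP hl.
apply: (ptime_ext (f := fun x => ~~ nilp [seq a <- l x | P x a])).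
  by move=> x; rewrite /nilp size_filter has_count lt0n.
by apply: ptime_nonempty; apply: ptime_filter.
Qed.

Lemma ptime_all (X A : ctype) (P : X -> A -> bool) (l : X -> seq A) :
  ptime (fun p : X * A => P p.1 p.2) -> ptime l ->
  ptime (fun x => all (P x) (l x)).
Proof.
move=> hP hl.
apply: (ptime_ext (f := fun x => ~~ has (fun a => ~~ P x a) (l x))).
  by move=> x; rewrite -all_predC; apply: eq_all => a /=; rewrite negbK.
apply: ptime_negb; apply: (ptime_has (P := fun x a => ~~ P x a)) => //.
exact: ptime_negb.
Qed.

Lemma ptime_size_seq (X A : ctype) (l : X -> seq A) :
  ptime l -> ptime (fun x => size (l x)).
Proof.
move=> hl.
have E (x : X) l1 : foldl (fun n (_ : A) => n.+1) 0 l1 = size l1.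
  by elim/last_ind: l1 => // l1 a IH; rewrite foldl_rcons size_rcons IH.
apply: (ptime_ext (f := fun x => foldl (fun n (_ : A) => n.+1) 0 (l x))).
  by move=> x; apply: (E x).
apply: (ptime_foldl (F := fun (_ : X) n (_ : A) => n.+1)) => //.
- exact: ptime_succ (ptime_snd (ptime_fst (ptime_id _))).
- exact: ptime_const.
exists (fun x => 2 * csz (l x)).
  by apply: pbnd_mul; [exact: pbnd_const | exact: ptime_size].
move=> x l1 l2 El; rewrite (E x) [csz (size _)]/=.
by have := leq_trans (size_csz l1) (csz_catl l1 l2); rewrite -El; lia.
Qed.

Lemma ptime_addn (X : ctype) (m n : X -> nat) :
  ptime m -> ptime n -> ptime (fun x => m x + n x).
Proof.
move=> hm hn; apply: (ptime_ext (f := fun x => iter (m x) S (n x))).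
  by move=> x; rewrite iter_succn addnC.
apply: (ptime_iter (F := fun=> S)) => //.
  exact: ptime_succ (ptime_snd (ptime_id _)).
exists (fun x => csz (m x) + csz (n x)).
  by apply: pbnd_add; exact: ptime_size.
by move=> x i lei; rewrite iter_succn /=; lia.
Qed.

Lemma ptime_muln (X : ctype) (m : X -> nat) k : ptime m -> ptime (fun x => k * m x).
Proof.
move=> hm; elim: k => [|k IH]; first exact: ptime_const.
by apply: (ptime_ext (f := fun x => m x + k * m x)) => //; apply: ptime_addn.
Qed.

Lemma ptime_subn (X : ctype) (m n : X -> nat) :
  ptime m -> ptime n -> ptime (fun x => m x - n x).
Proof.
move=> hm hn.
have E (a b : nat) : iter b predn a = a - b.
  by elim: b => /= [|b ->]; rewrite ?subn0 // subnS.
apply: (ptime_ext (f := fun x => iter (n x) predn (m x))).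
  by move=> x; apply: E.
apply: (ptime_iter (F := fun=> predn)) => //.
  exact: ptime_pred (ptime_snd (ptime_id _)).
exists (fun x => csz (m x)); first exact: ptime_size.
by move=> x i lei; rewrite E /=; lia.
Qed.

Lemma ptime_leq (X : ctype) (m n : X -> nat) :
  ptime m -> ptime n -> ptime (fun x => m x <= n x).
Proof.
move=> hm hn; apply: (ptime_ext (f := fun x => ~~ (0 < m x - n x))).
  by move=> x; rewrite subn_gt0 -leqNgt.
by apply: ptime_negb; apply: ptime_gt0; apply: ptime_subn.
Qed.

Lemma csz_iota m k : csz (iota m k) <= k * (2 * (m + k)).+2 + 1.
Proof. by elim: k m => //= k IH m; have := IH m.+1; nia. Qed.

Lemma ptime_iota (X : ctype) (n : X -> nat) :
  ptime n -> ptime (fun x => iota 0 (n x)).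
Proof.
move=> hn; pose F (p : seq nat * nat) := (p.2 :: p.1, p.2.+1).
have E i : iter i F ([::], 0) = (rev (iota 0 i), i).
  by elim: i => // i IH; rewrite iterS IH; congr pair; rewrite -addn1 iotaD rev_cat.
apply: (ptime_ext (f := fun x => rev (iter (n x) F ([::], 0)).1)).
  by move=> x; rewrite E revK.
apply: ptime_rev; apply: ptime_fst; apply: (ptime_iter (F := fun=> F)) => //.
- apply: ptime_pair.
    apply: ptime_cons; first exact: ptime_snd (ptime_snd (ptime_id _)).
    exact: ptime_fst (ptime_snd (ptime_id _)).
  exact: ptime_succ (ptime_snd (ptime_snd (ptime_id _))).
- exact: ptime_const.
exists (fun x => csz (n x) * (2 * csz (n x) + 2) + 2 * csz (n x) + 4).
  have bn := ptime_size hn.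
  by pbnd_sum.
move=> x i lei; rewrite E [csz _]/= -[foldr _ _ _]/(csz (rev (iota 0 i))) csz_rev.
have := csz_iota 0 i; rewrite [csz (n x)]/=; nia.
Qed.

(** Recursion is on the first list alone, so that this is a fold whose accumulator carries the rest
    of the second list. *)
Fixpoint zipd (A B : Type) (b0 : B) (s : seq A) (t : seq B) : seq (A * B) :=
  if s is a :: s' then (a, head b0 t) :: zipd b0 s' (behead t) else [::].

Lemma csz_behead (A : ctype) (s : seq A) : csz (behead s) <= csz s.
Proof. by case: s => //= a s; rewrite leqW // leq_addl. Qed.

Lemma csz_head (A : ctype) (a0 : A) (s : seq A) :
  csz (head a0 s) <= csz a0 + csz s.
Proof. by case: s => [|a s] /=; lia. Qed.

Lemma ptime_zipd (X A B : ctype) (b0 : B) (f : X -> seq A) (g : X -> seq B) :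
  ptime f -> ptime g -> ptime (fun x => zipd b0 (f x) (g x)).
Proof.
move=> hf hg.
pose F (q : seq (A * B) * seq B) (a : A) :=
  ((a, head b0 q.2) :: q.1, behead q.2).
have E s : forall t r, (foldl F (r, t) s).1 = catrev (zipd b0 s t) r.
  by elim: s => //= a s IH t r; rewrite IH.
apply: (ptime_ext (f := fun x => rev (foldl F ([::], g x) (f x)).1)).
  by move=> x; rewrite E catrevE cats0 revK.
apply: ptime_rev; apply: ptime_fst.
have p2 : ptime (fun p : X * (seq (A * B) * seq B) * A => p.1.2).
  exact: ptime_snd (ptime_fst (ptime_id _)).
apply: (ptime_foldl (F := fun=> F)) => //.
- apply: ptime_pair; last exact: ptime_behead (ptime_snd p2).
  apply: ptime_cons; last exact: ptime_fst p2.
  apply: ptime_pair; first exact: ptime_snd (ptime_id _).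
  exact: ptime_head (ptime_snd p2).
- by apply: ptime_pair => //; apply: ptime_const.
exists (fun x => csz (f x) * (csz b0 + csz (g x) + 3) + csz (g x) + 3).
  have bf := ptime_size hf; have bg := ptime_size hg.
  by pbnd_sum.
have H s : forall (t : seq B) r,
    csz (foldl F (r, t) s) <= csz s * (csz b0 + csz t + 3) + csz r + csz t + 1.
  elim: s => [|a s IH] t r; first by rewrite csz_pairE; lia.
  apply: leq_trans (IH _ _) _; rewrite !csz_consE csz_pairE.
  have lt := csz_behead t; have := csz_head b0 t.
  have := leq_mul (leqnn (csz s)) lt; have := leq0n (csz a * (csz b0 + csz t)).
  by move: lt; rewrite -[(r, t).2]/t -[(r, t).1]/r mulSn !mulnDr !mulnDl; lia.
move=> x l1 l2 El; apply: leq_trans (H _ _ _) _.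
have := csz_catl l1 l2; rewrite -El csz_nilE => le1.
by have := leq_mul le1 (leqnn (csz b0 + csz (g x) + 3)); lia.
Qed.

(** * The reduction *)

Definition agreement (u v : seq bool) : nat :=
  size [seq p <- zipd false u v | p.1 == p.2].

Definition balanced K (u v : seq bool) : bool :=
  (3 * K <= agreement u v) && (agreement u v <= 4 * K).

Definition extend (W : seq (seq bool)) : seq (seq bool) :=
  map (cons false) W ++ map (cons true) W.

Definition words n : seq (seq bool) := iter n extend [:: [::]].

(** A state consists of the candidates balanced with all words chosen so far, and of the chosen
    words, latest first. For positive [K] the filter also removes the new word itself, which agrees
    with itself in all [7 * K] positions. *)
Definition greedy_step K (st : seq (seq bool) * seq (seq bool)) :=
  if ~~ nilp st.1 then
    ([seq v <- st.1 | balanced K (head [::] st.1) v], head [::] st.1 :: st.2)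
  else st.

Definition greedy_code K M : seq (seq bool) :=
  (iter M (greedy_step K) (words (7 * K), [::])).2.

(** Doubling until [R] is reached. Loops need a bound known in advance, and [R] rounds suffice
    because R <= 2^R. *)
Definition log_step R (p : nat * nat) : nat * nat :=
  if ~~ (R <= p.2) then (p.1.+1, p.2 + p.2) else p.

Definition log_above R : nat := (iter R (log_step R) (0, 1)).1.

Local Notation literal := (nat * bool)%type.

(** The literal (i, b) owns entry 2 i + b of the code. *)
Definition word (T : seq (seq bool)) (l : literal) : seq bool :=
  head [::] (iter l.1 (fun t => behead (behead t)) (if l.2 then behead T else T)).

(** A signed power of 1/2: its binary encoding displays the sign and the exponent, so it is written
    and read without arithmetic. Its absolute value is at most 1/2, so two markers differ by at most
    1. *)
Definition marker (b : bool) (i : nat) : rat := ((-1) ^+ b / 2 ^+ i.+1)%R.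

(** Relative to the centre 21/2, a facility has coordinates 21/2 times a sign, and a client (with
    the offset 9 below) half the sum of three signs. With t agreements they differ by 12 - t up to
    sign. Any scale above 14 in place of 21 would produce a gap, with the offset adjusted; 21 makes
    it exactly 105 against 106 per coordinate. *)
Definition facility_coord (b : bool) : rat := if b then 21%:R%R else 0%R.

Definition client_coord (q : bool * (bool * bool)) : rat :=
  (9 + q.1 + q.2.1 + q.2.2)%:R%R.

Definition facility_point T (l : literal) : seq rat :=
  marker l.2 l.1 :: [seq facility_coord b | b <- word T l].

Definition clause_lit (c : seq literal) i : literal := nth (0, false) c i.

Definition client_point T (p : nat * seq literal) : seq rat :=
  marker false p.1 :: [seq client_coord q | q <-
    zipd (false, false) (word T (clause_lit p.2 0))
      (zipd false (word T (clause_lit p.2 1)) (word T (clause_lit p.2 2)))].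

Definition tautology i : seq literal := [:: (i, true); (i, false); (i, false)].

(* The greedy choice discards a proportion of at most [2 * (7 ^ 7 / (4 ^ 4 * 3 ^ 3
   * 2 ^ 7)) ^ K] of all words at each step, which is at most [2 ^ (1 - log)] for
   [K = 14 * log], as the inverse of the ratio exceeds 15/14. *)
Definition rate n : nat := 14 * log_above (4 * n.+1).

Definition codebook n : seq (seq bool) := greedy_code (rate n) (2 * n.+1).

Definition clauses_of (x : nat * seq (seq literal)) : seq (seq literal) :=
  x.2 ++ [seq tautology i | i <- iota 0 x.1.+1].

Definition client_points (x : nat * seq (seq literal)) : seq (seq rat) :=
  [seq client_point (codebook x.1) p
     | p <- zipd [::] (iota 0 (size (clauses_of x))) (clauses_of x)].

Definition facility_points (n : nat) : seq (seq rat) :=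
  [seq facility_point (codebook n) (i, false) | i <- iota 0 n.+1] ++
  [seq facility_point (codebook n) (i, true) | i <- iota 0 n.+1].

Definition dimension n : nat := (7 * rate n).+1.

Definition reduction (x : nat * seq (seq literal)) :=
  (dimension x.1, (client_points x, (facility_points x.1, x.1.+1))).

(** * Polynomial time of the reduction *)

Ltac ptime_proj :=
  repeat first [exact: ptime_id | apply: ptime_fst | apply: ptime_snd].

Lemma ptime_agreement (X : ctype) (u v : X -> seq bool) :
  ptime u -> ptime v -> ptime (fun x => agreement (u x) (v x)).
Proof.
move=> hu hv; apply: ptime_size_seq.
apply: (ptime_filter (P := fun _ (p : bool * bool) => p.1 == p.2)).
  by apply: ptime_eqb; ptime_proj.
exact: ptime_zipd.
Qed.

Lemma ptime_balanced (X : ctype) (K : X -> nat) (u v : X -> seq bool) :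
  ptime K -> ptime u -> ptime v -> ptime (fun x => balanced (K x) (u x) (v x)).
Proof.
move=> hK hu hv; apply: ptime_andb; apply: ptime_leq;
  by [apply: ptime_muln | apply: ptime_agreement].
Qed.

Lemma size_words n : size (words n) = 2 ^ n.
Proof.
elim: n => // n IH; rewrite /words iterS -/(words n) /extend.
by rewrite size_cat !size_map IH expnS mul2n addnn.
Qed.

Lemma csz_words n : csz (words n) <= 2 ^ n * (4 * n + 2) + 1.
Proof.
elim: n => // n IH; rewrite /words iterS -/(words n) /extend.
have E b : csz [seq b :: w | w <- words n] <= csz (words n) + size (words n) * 4.
  elim: (words n) => // w W; rewrite map_cons !csz_consE.
  have : csz b <= 3 by case: b.
  by rewrite [size (w :: W)]/=; lia.
rewrite -ltnS csz_cat; have := E false; have := E true.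
rewrite size_words expnS; move: (2 ^ n) IH => z.
by set a := csz (words n); set b := csz _; set c := csz _; nia.
Qed.

Lemma ptime_words (X : ctype) (n : X -> nat) :
  ptime n -> pbnd csz (fun x => 2 ^ n x) -> ptime (fun x => words (n x)).
Proof.
move=> hn b2; apply: (ptime_iter (F := fun=> extend)) => //.
- by apply: ptime_cat; apply: (ptime_map (F := fun _ => _));
    [apply: ptime_cons; [exact: ptime_const | ptime_proj] | ptime_proj
    |apply: ptime_cons; [exact: ptime_const | ptime_proj] | ptime_proj].
- exact: ptime_const.
exists (fun x => 2 ^ n x * (4 * csz (n x) + 2) + 1).
  have bn := ptime_size hn.
  by pbnd_sum.
move=> x i lei; apply: leq_trans (csz_words i) _; rewrite leq_add2r.
by apply: leq_mul; [rewrite leq_exp2l | rewrite [csz _]/=; lia].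
Qed.

Lemma csz_filter (A : ctype) (P : pred A) (s : seq A) : csz [seq x <- s | P x] <= csz s.
Proof. by elim: s => //= a s IH; case: (P a) => /=; lia. Qed.

Lemma csz_head_le (A : ctype) (a0 : A) (s : seq A) : ~~ nilp s -> csz (head a0 s) < csz s.
Proof. by case: s => //= a s _; rewrite ltnS leq_addr. Qed.

Lemma csz_greedy K i W : let st := iter i (greedy_step K) (W, [::]) in
  csz st.1 <= csz W /\ csz st.2 <= i * csz W + 1.
Proof.
elim: i => [|i] /=; first by split.
set st := iter i _ _ => -[le1 le2]; rewrite /greedy_step.
case: ifP => [nz|_]; last by split=> //; rewrite mulSn; lia.
split; first exact: leq_trans (csz_filter _ _) le1.
rewrite [csz (_ :: _)]csz_consE mulSn -addSn -addnA.
by apply: leq_add le2; apply: leq_trans (csz_head_le _ nz) le1.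
Qed.

Lemma ptime_greedy_code (X : ctype) (K M : X -> nat) :
  ptime K -> ptime M -> pbnd csz (fun x => 2 ^ (7 * K x)) ->
  ptime (fun x => greedy_code (K x) (M x)).
Proof.
move=> hK hM bK; apply: ptime_snd.
have hW : ptime (fun x => words (7 * K x)).
  by apply: ptime_words => //; apply: ptime_muln.
apply: (ptime_iter (F := fun x => greedy_step (K x))) => //.
- have h1 : ptime (fun p : X * (seq (seq bool) * seq (seq bool)) => p.2.1).
    by ptime_proj.
  apply: ptime_if; [exact: ptime_nonempty | | by ptime_proj].
  apply: ptime_pair; last first.
    by apply: ptime_cons; [exact: ptime_head | ptime_proj].
  apply: (ptime_filter (P := fun (p : X * (seq (seq bool) * seq (seq bool))) v =>
    balanced (K p.1) (head [::] p.2.1) v)) => //.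
  apply: ptime_balanced; [|apply: ptime_head |]; try by ptime_proj.
  by apply: (ptime_comp (g := K)) => //; ptime_proj.
- by apply: ptime_pair => //; apply: ptime_const.
exists (fun x => csz (words (7 * K x)) + (csz (M x) * csz (words (7 * K x)) + 1) + 1).
  have bn := ptime_size hM; have bW := ptime_size hW.
  by pbnd_sum.
move=> x i lei; have [le1 le2] := csz_greedy (K x) i (words (7 * K x)).
rewrite [csz (iter _ _ _)]/= -/(csz _) addn1 ltnS; apply: leq_add le1 _.
apply: leq_trans le2 _; rewrite leq_add2r leq_mul2r; apply/orP; right.
by rewrite [csz _]/=; lia.
Qed.

Lemma log_stepP R i : let p := iter i (log_step R) (0, 1) in
  [/\ p.2 = 2 ^ p.1, p.1 <= i, (R <= p.2) || (i <= p.1) & 0 < R -> p.2 < 2 * R].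
Proof.
elim: i => [|i] /=; first by split=> //; lia.
set p := iter i _ _ => -[E l h1 h2]; rewrite /log_step.
case: (leqP R p.2) h1 => le_R /= h1; first by split=> //; [lia | rewrite le_R].
split=> /=; [by rewrite expnS E mul2n addnn | lia | by rewrite [i < _]ltnS h1 orbT | lia].
Qed.

Lemma log_aboveP R : 0 < R -> R <= 2 ^ log_above R < 2 * R.
Proof.
move=> R0; have [E l h1 h2] := log_stepP R R.
rewrite /log_above -E h2 // andbT; case/orP: h1 => // h1.
by rewrite E; apply: leq_trans (ltnW (ltn_expl _ (ltnSn 1))) _; rewrite leq_exp2l.
Qed.

Lemma ptime_log_above (X : ctype) (R : X -> nat) :
  ptime R -> ptime (fun x => log_above (R x)).
Proof.
move=> hR; apply: ptime_fst; apply: (ptime_iter (F := fun x => log_step (R x))) => //.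
- apply: ptime_if; last by ptime_proj.
    apply: ptime_negb; apply: ptime_leq; last by ptime_proj.
    by apply: (ptime_comp (g := R)) => //; ptime_proj.
  apply: ptime_pair; first by apply: ptime_succ; ptime_proj.
  by apply: ptime_addn; ptime_proj.
- exact: ptime_const.
exists (fun x => 6 * csz (R x) + 10).
  have bR := ptime_size hR; by pbnd_sum.
move=> x i lei; have [E l h1 h2] := log_stepP (R x) i.
have : (iter i (log_step (R x)) (0, 1)).2 <= 2 * R x + 1.
  case: (posnP (R x)) => [R0|/h2]; last by lia.
  by move: lei; rewrite R0 leqn0 => /eqP->.
by move: (iter _ _ _) l => [a b] /=; lia.
Qed.

Lemma ptime_word (X : ctype) (T : X -> seq (seq bool)) (l : X -> literal) :
  ptime T -> ptime (l : X -> nat * bool) -> ptime (fun x => word (T x) (l x)).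
Proof.
move=> hT hl; apply: ptime_head.
apply: (ptime_iter (F := fun _ t => behead (behead t))).
- by do !apply: ptime_behead; ptime_proj.
- by apply: ptime_if => //; [ptime_proj | apply: ptime_behead].
- exact: ptime_fst.
exists (fun x => csz (T x)); first exact: ptime_size.
move=> x i _; elim: i => [|i IH] /=.
  by case: ifP => // _; exact: csz_behead.
by apply: leq_trans (csz_behead _) _; apply: leq_trans (csz_behead _) IH.
Qed.

Lemma enc_pos_double p k :
  enc_pos (iter k BinNums.xO p) = iter k (Defs.Cons Leaf) (enc_pos p).
Proof. by elim: k => //= k ->. Qed.

Lemma nat_of_pos_pow2 k :
  nat_of_bin (BinNums.Npos (iter k BinNums.xO BinNums.xH)) = 2 ^ k.
Proof.
elim: k => // k IH; rewrite expnS -IH /= NatTrec.doubleE.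
by rewrite mul2n.
Qed.

(** Digits are listed from the least significant one, so the [k] zeros of the power form a unary
    numeral. *)
Lemma enc_binary_pow2 k : enc_binary (2 ^ k) = Defs.Cons Leaf (enc_unary k).
Proof.
rewrite /enc_binary -nat_of_pos_pow2 nat_of_binK; congr Defs.Cons.
exact: enc_pos_double.
Qed.

Lemma enc_marker b i : enc_rat (marker b i) =
  Defs.Cons (Defs.Cons (enc_bool b) (Defs.Cons Leaf Leaf))
    (Defs.Cons Leaf (Defs.Cons Leaf (enc_unary i.+1))).
Proof.
have cop : coprime `|((-1) ^+ b)%R : int| `|(2 ^ i.+1)%N : int|.
  by case: b; rewrite /= coprime1n.
have -> : marker b i = (((-1) ^+ b)%R%:~R / ((2 ^ i.+1)%N : int)%:~R)%R.
  by rewrite /marker rmorphXn /= rmorphN1 -pmulrn natrX.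
have pos : (2 ^ i.+1)%N != 0 by rewrite expn_eq0.
rewrite /enc_rat coprimeq_num // coprimeq_den //.
have -> : (((2 ^ i.+1)%N : int) == 0)%R = false by apply/negbTE.
rewrite gtr0_sg ?mul1r; last by rewrite ltz_nat lt0n.
rewrite ger0_norm //; congr Defs.Cons; first by case: b {cop}.
by rewrite /enc_int absz_nat enc_binary_pow2.
Qed.

Lemma tsize_unary n : Defs.tsize (enc_unary n) = n.*2.+1.
Proof. by elim: n => //= n ->; rewrite doubleS. Qed.

Lemma ptime_marker (X : ctype) (b : X -> bool) (i : X -> nat) :
  ptime b -> ptime i -> ptime (fun x => marker (b x) (i x)).
Proof.
apply: (ptime_comp2 (h := marker)).
apply: (ptime_expr (e := ECons (ECons (EHd (EVar 0)) (ECons ELeaf ELeaf))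
  (ECons ELeaf (ECons ELeaf (ECons ELeaf (ETl (EVar 0))))))).
  by move=> [c n] s /= ->; rewrite enc_marker.
apply: (@pbnd_le _ _ _ (fun p : bool * nat => csz p + 12)) => [[c n]|].
  have -> : csz (marker c n) = Defs.tsize (enc_rat (marker c n)) by [].
  by rewrite enc_marker csz_pairE /= tsize_unary; case: c => /=; lia.
by pbnd_sum.
Qed.

Lemma ptime_facility_coord (X : ctype) (b : X -> bool) :
  ptime b -> ptime (fun x => facility_coord (b x)).
Proof. by move=> hb; apply: ptime_if => //; apply: ptime_const. Qed.

(** A table of the eight possible values, so that no rational arithmetic has to be programmed. *)
Lemma ptime_client_coord (X : ctype) (q : X -> bool * (bool * bool)) :
  ptime q -> ptime (fun x => client_coord (q x)).
Proof.
move=> hq; apply: (ptime_ext (f := fun x => if (q x).1 then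
    if (q x).2.1 then if (q x).2.2 then client_coord (true, (true, true))
                      else client_coord (true, (true, false))
    else if (q x).2.2 then client_coord (true, (false, true))
                      else client_coord (true, (false, false))
  else
    if (q x).2.1 then if (q x).2.2 then client_coord (false, (true, true))
                      else client_coord (false, (true, false))
    else if (q x).2.2 then client_coord (false, (false, true))
                      else client_coord (false, (false, false)))).
  by move=> x; case: (q x) => [[] [[] []]].
by do !apply: ptime_if; first [exact: ptime_const | ptime_proj; exact: hq].
Qed.

Lemma ptime_facility_point (X : ctype) (T : X -> seq (seq bool)) (l : X -> literal) :
  ptime T -> ptime (l : X -> nat * bool) -> ptime (fun x => facility_point (T x) (l x)).
Proof.
move=> hT hl; apply: ptime_cons.
  by apply: ptime_marker; [exact: ptime_snd | exact: ptime_fst].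
apply: (ptime_map (F := fun=> facility_coord)); last exact: ptime_word.
by apply: ptime_facility_coord; ptime_proj.
Qed.

Lemma ptime_clause_lit (X : ctype) (c : X -> seq literal) i :
  ptime (c : X -> seq (nat * bool)) ->
  ptime ((fun x => clause_lit (c x) i) : X -> nat * bool).
Proof.
move=> hc; apply: (ptime_ext (f := fun x =>
    head (0, false) (iter i behead (c x)) : nat * bool)).
  move=> x; rewrite /clause_lit -nth0; elim: i (c x) => // i IH l.
  by rewrite iterSr IH; case: l => //=; rewrite nth_nil.
apply: ptime_head; apply: ptime_iter_const => //.
by apply: ptime_behead; ptime_proj.
Qed.

Lemma ptime_client_point (X : ctype) (T : X -> seq (seq bool))
    (p : X -> nat * seq literal) :
  ptime T -> ptime (p : X -> nat * seq (nat * bool)) ->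
  ptime (fun x => client_point (T x) (p x)).
Proof.
move=> hT hp; apply: ptime_cons.
  by apply: ptime_marker; [exact: ptime_const | exact: ptime_fst].
apply: (ptime_map (F := fun=> client_coord)).
  by apply: ptime_client_coord; ptime_proj.
have hw i : ptime (fun x => word (T x) (clause_lit (p x).2 i)).
  by apply: ptime_word => //; apply: ptime_clause_lit; apply: ptime_snd.
by do !apply: ptime_zipd.
Qed.

Lemma ptime_rate (X : ctype) (n : X -> nat) : ptime n -> ptime (fun x => rate (n x)).
Proof.
move=> hn; apply: ptime_muln; apply: ptime_log_above; apply: ptime_muln.
exact: ptime_succ.
Qed.

(** The left side is the number of words searched by the greedy choice; 98 is 7 * 14, and 2^log is
    below 2 * 4 * (n + 1). *)
Lemma rate_bound n : 2 ^ (7 * rate n) <= (8 * n.+1) ^ 98.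
Proof.
have -> : 7 * rate n = log_above (4 * n.+1) * 98.
  by rewrite /rate mulnA mulnC.
rewrite expnM; apply: leq_expn_base.
have /andP[_ /ltnW] := log_aboveP (isT : 0 < 4 * n.+1).
by rewrite mulnA.
Qed.

Lemma ptime_codebook (X : ctype) (n : X -> nat) :
  ptime n -> ptime (fun x => codebook (n x)).
Proof.
move=> hn; apply: ptime_greedy_code.
- exact: ptime_rate.
- by apply: ptime_muln; apply: ptime_succ.
apply: (pbnd_le (fun x => rate_bound (n x))); apply: pbnd_expr.
apply: (@pbnd_le _ _ _ (fun x => 8 * (csz (n x) + 1))) => [x /=|]; first by lia.
by have bn := ptime_size hn; pbnd_sum.
Qed.

Lemma ptime_tautologies (X : ctype) (n : X -> nat) : ptime n ->
  ptime ((fun x => [seq tautology i | i <- iota 0 (n x)]) : X -> seq (seq (nat * bool))).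
Proof.
move=> hn; apply: (ptime_map (F := fun=> tautology)); last exact: ptime_iota.
by do !apply: ptime_cons;
  first [exact: ptime_const | apply: ptime_pair; [ptime_proj | exact: ptime_const]].
Qed.

Lemma ptime_clauses_of (X : ctype) (f : X -> nat * seq (seq (nat * bool))) :
  ptime f -> ptime ((fun x => clauses_of (f x)) : X -> seq (seq (nat * bool))).
Proof.
move=> hf; apply: ptime_cat; first exact: ptime_snd.
by apply: ptime_tautologies; apply: ptime_succ; apply: ptime_fst.
Qed.

Lemma ptime_client_points (X : ctype) (f : X -> nat * seq (seq (nat * bool))) :
  ptime f -> ptime (fun x => client_points (f x)).
Proof.
move=> hf; have hc := ptime_clauses_of hf.
apply: (ptime_map (F := fun x => client_point (codebook (f x).1))).
  apply: ptime_client_point; last by ptime_proj.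
  apply: ptime_codebook; apply: ptime_fst.
  by apply: (ptime_comp (g := f)) => //; ptime_proj.
apply: ptime_zipd => //; apply: ptime_iota.
by apply: (ptime_size_seq (A := seq_ct (prod_ct nat_ct bool_ct))).
Qed.

Lemma ptime_facility_points (X : ctype) (n : X -> nat) :
  ptime n -> ptime (fun x => facility_points (n x)).
Proof.
move=> hn.
have h b : ptime (fun x =>
    [seq facility_point (codebook (n x)) (i, b) | i <- iota 0 (n x).+1]).
  apply: (ptime_map (F := fun x i => facility_point (codebook (n x)) (i, b))).
    apply: ptime_facility_point.
      by apply: ptime_codebook; apply: (ptime_comp (g := n)) => //; ptime_proj.
    by apply: ptime_pair; [ptime_proj | exact: ptime_const].
  by apply: ptime_iota; apply: ptime_succ.
exact: ptime_cat.
Qed.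

Lemma ptime_reduction (X : ctype) (f : X -> nat * seq (seq (nat * bool))) :
  ptime f -> ptime (fun x => reduction (f x)).
Proof.
move=> hf; have h1 := ptime_fst hf; apply: ptime_pair.
  by apply: ptime_succ; apply: ptime_muln; apply: ptime_rate.
apply: ptime_pair; first exact: ptime_client_points.
by apply: ptime_pair; [exact: ptime_facility_points | exact: ptime_succ].
Qed.

(** * Nearly orthogonal codes *)

Lemma agreement_cons a u v :
  agreement (a :: u) v = (a == head false v) + agreement u (behead v).
Proof. by rewrite /agreement /=; case: eqP. Qed.

Lemma agreement_le u v : agreement u v <= size u.
Proof.
elim: u v => // a u IH v; rewrite agreement_cons /= -add1n leq_add //.
exact: leq_b1.
Qed.

Lemma agreement_refl u : agreement u u = size u.
Proof. by elim: u => // a u IH; rewrite agreement_cons /= eqxx IH. Qed.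

Lemma agreement_sym u v : size u = size v -> agreement u v = agreement v u.
Proof.
elim: u v => [|a u IH] [|b v] //= [E]; rewrite !agreement_cons /= IH //.
by rewrite eq_sym.
Qed.

Lemma size_word_mem n w : w \in words n -> size w = n.
Proof.
elim: n w => [w|n IH w]; first by rewrite inE => /eqP->.
rewrite /words iterS -/(words n) /extend mem_cat.
by case/orP=> /mapP[v /IH <- ->].
Qed.

(** The sum factors over the positions: at each one, the agreeing letter contributes [x] and the
    other letter [y]. *)
Lemma sum_agreement x y u :
  \sum_(v <- words (size u)) x ^ agreement u v * y ^ (size u - agreement u v)
    = (x + y) ^ size u.
Proof.
elim: u => [|a u IH]; first by rewrite big_seq1 expn0 muln1.
rewrite /words iterS -/(words _) /extend big_cat !big_map /=.
have E b : \sum_(v <- words (size u)) x ^ agreement (a :: u) (b :: v) *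
    y ^ ((size u).+1 - agreement (a :: u) (b :: v)) =
    (if a == b then x else y) * (x + y) ^ size u.
  rewrite -IH big_distrr /=; apply: eq_bigr => v _.
  rewrite agreement_cons /=; case: eqP => _ /=.
    by rewrite add1n subSS expnS mulnA.
  by rewrite add0n subSn ?agreement_le // expnS mulnCA.
by rewrite !E -mulnDl expnS; case: (a) => //=; rewrite addnC.
Qed.

(** Markov's inequality for counting. *)
Lemma count_weight (T : eqType) (s : seq T) (P : pred T) (f : T -> nat) c :
  (forall v, P v -> c <= f v) -> c * count P s <= \sum_(v <- s) f v.
Proof.
move=> h; elim: s => [|v s IH]; first by rewrite muln0.
rewrite big_cons /= mulnDr leq_add //; case: (boolP (P v)) => [/h|_].
  by rewrite muln1.
by rewrite muln0.
Qed.

Lemma leq_exp_transfer x y a b e : x <= y -> x ^ (a + e) * y ^ b <= x ^ a * y ^ (b + e).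
Proof.
move=> le_xy; rewrite !expnD -mulnA leq_mul2l mulnC leq_mul2l leq_expn_base //.
by rewrite !orbT.
Qed.

(* Chernoff bound: weighting the agreeing and disagreeing positions by 4 and 3,
   or by 3 and 4, makes the total weight of all words equal to [7 ^ (7 * K)]. *)
Lemma count_unbalanced K u : size u = 7 * K ->
  4 ^ (4 * K) * 3 ^ (3 * K) * count (fun v => ~~ balanced K u v) (words (7 * K))
    <= 2 * 7 ^ (7 * K).
Proof.
move=> su; rewrite -su.
pose P1 v := 4 * K <= agreement u v; pose P2 v := agreement u v <= 3 * K.
apply: (@leq_trans (4 ^ (4 * K) * 3 ^ (3 * K) *
    (count P1 (words (size u)) + count P2 (words (size u))))).
  rewrite leq_mul2l -count_predUI; apply/orP; right.
  apply: leq_trans (leq_addr _ _); apply: sub_count => v.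
  by rewrite /balanced negb_and -!ltnNge /= /P1 /P2 => /orP[] /ltnW ->; rewrite ?orbT.
rewrite mulnDr mul2n -addnn.
have S1 : 7 ^ size u = _ := esym (sum_agreement 4 3 u).
have S2 : 7 ^ size u = _ := esym (sum_agreement 3 4 u).
apply: leq_add; [rewrite S1 | rewrite S2];
  apply: count_weight => v; have := agreement_le u v; rewrite /P1 /P2 su => le1 le2.
  have := leq_exp_transfer (7 * K - agreement u v) (4 * K)
    (agreement u v - 4 * K) (isT : 3 <= 4).
  rewrite subnKC // [X in X <= _]mulnC [X in _ <= X]mulnC.
  by have -> : 7 * K - agreement u v + (agreement u v - 4 * K) = 3 * K by lia.
have := leq_exp_transfer (agreement u v) (4 * K) (3 * K - agreement u v) (isT : 3 <= 4).
rewrite subnKC // mulnC.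
by have -> : 4 * K + (3 * K - agreement u v) = 7 * K - agreement u v by lia.
Qed.

(** The last bound is the count of surviving candidates, multiplied by [B] to stay in the natural
    numbers: by [count_unbalanced], a step discards at most 2 * 7^(7 K) / B of them. *)
Lemma greedy_step_invariant K i :
  let st := iter i (greedy_step K) (words (7 * K), [::]) in
  let B := 4 ^ (4 * K) * 3 ^ (3 * K) in
  [/\ subseq st.1 (words (7 * K)),
      {subset st.2 <= words (7 * K)},
      all (fun u => all (balanced K u) st.1) st.2,
      pairwise (fun v u => balanced K u v) st.2 &
      B * 2 ^ (7 * K) <= B * size st.1 + i * (2 * 7 ^ (7 * K))].
Proof.
elim: i => [|i] /=; first by split=> //; rewrite size_words addn0.
set st := iter i _ _; set B := _ * _ => -[sub1 sub2 al pw le1]; rewrite /greedy_step.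
case: ifP => [nz|_]; last by split=> //; lia.
have [u [W Est]] : exists u W, st.1 = u :: W.
  by case: (st.1) nz => // u W _; exists u, W.
have uW : u \in words (7 * K) by apply: (mem_subseq sub1); rewrite Est mem_head.
have -> : head [::] st.1 = u by rewrite Est.
split=> /=.
- exact: subseq_trans (filter_subseq _ _) sub1.
- by move=> v; rewrite inE => /orP[/eqP->//|/sub2].
- rewrite filter_all /=; apply/allP => v /(allP al) /allP h; apply/allP => w.
  by rewrite mem_filter => /andP[_ /h].
- rewrite pw andbT; apply/allP => v /(allP al) /allP; apply.
  by rewrite Est mem_head.
rewrite [i.+1 * _]mulSn addnA; apply: leq_trans le1 _; rewrite leq_add2r.
rewrite -(count_predC (balanced K u) st.1) mulnDr -size_filter leq_add2l.
apply: leq_trans (count_unbalanced (size_word_mem uW)).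
by rewrite leq_mul2l leq_count_subseq ?orbT.
Qed.

(** A step adds no word only if no candidate is left, and then the last bound of the invariant
    contradicts the hypothesis. *)
Lemma pairwise_balanced_code K M : 0 < K ->
  (forall i, i < M -> i * (2 * 7 ^ (7 * K)) < 4 ^ (4 * K) * 3 ^ (3 * K) * 2 ^ (7 * K)) ->
  [/\ size (greedy_code K M) = M, {subset greedy_code K M <= words (7 * K)} &
      pairwise (fun v u => balanced K u v) (greedy_code K M)].
Proof.
move=> K0 hM; have [_ sub _ pw _] := greedy_step_invariant K M.
split=> //; rewrite /greedy_code; move: hM; clear.
elim: M => //= M IH hM; have [_ _ _ _ le1] := greedy_step_invariant K M.
rewrite /greedy_step; case: ifP => [_|/negbFE/nilP E] /=.
  by rewrite IH // => i lei; apply: hM; apply: leq_trans lei _.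
by move: le1 (hM M (ltnSn M)); rewrite E muln0 add0n => /leq_ltn_trans h /h; rewrite ltnn.
Qed.

Lemma rate_gt0 n : 0 < rate n.
Proof.
rewrite /rate muln_gt0 /=; have /andP[le1 _] := log_aboveP (isT : 0 < 4 * n.+1).
by case: (log_above _) le1 => //; rewrite expn0; lia.
Qed.

Lemma ltn_mul_pow c e a m L :
  0 < c -> 2 * c ^ e <= a -> m < 2 ^ L -> m * (c ^ e) ^ L < a ^ L.
Proof.
move=> c0 le1 ltm; apply: leq_trans (leq_expn_base L le1).
by rewrite expnMn ltn_pmul2r // !expn_gt0 c0.
Qed.

Lemma expnM_mul3 a b c p q r L :
  a ^ (p * L) * b ^ (q * L) * c ^ (r * L) = (a ^ p * b ^ q * c ^ r) ^ L.
Proof. by rewrite !expnM !expnMn. Qed.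

(** Up to the factor 2 i, which is below 2^L, both sides are L-th powers; what remains is the
    numerical fact 2 * 7^98 <= 4^56 * 3^42 * 2^98. *)
Lemma greedy_rate n i : i < 2 * n.+1 ->
  i * (2 * 7 ^ (7 * rate n)) <
    4 ^ (4 * rate n) * 3 ^ (3 * rate n) * 2 ^ (7 * rate n).
Proof.
move=> lti; have /andP[le1 _] := log_aboveP (isT : 0 < 4 * n.+1).
rewrite /rate; move: (log_above _) le1 => L le1.
have -> : 4 * (14 * L) = 56 * L by rewrite mulnA.
have -> : 3 * (14 * L) = 42 * L by rewrite mulnA.
have -> : 7 * (14 * L) = 98 * L by rewrite mulnA.
rewrite expnM_mul3 [7 ^ _]expnM mulnA; apply: ltn_mul_pow; [by [] | by lia | ].
by apply: leq_trans le1; lia.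
Qed.

Lemma codebookP n : [/\ size (codebook n) = 2 * n.+1,
  {in codebook n, forall w, size w = 7 * rate n} &
  forall i j, i < 2 * n.+1 -> j < 2 * n.+1 -> i != j ->
    balanced (rate n) (nth [::] (codebook n) i) (nth [::] (codebook n) j)].
Proof.
have [sz sub pw] := pairwise_balanced_code (rate_gt0 n) (@greedy_rate n).
have szw : {in codebook n, forall w, size w = 7 * rate n}.
  by move=> w /sub /size_word_mem.
split=> // i j lti ltj; wlog ltij : i j lti ltj / i < j => [wl|_].
  case: (ltngtP i j) => // ij _; first by apply: wl => //; rewrite neq_ltn ij.
  have := wl j i ltj lti ij; rewrite eq_sym neq_ltn ij orbT => /(_ isT).
  by rewrite /balanced agreement_sym // !szw // mem_nth // sz.
have := pairwiseP [::] pw; rewrite -/(codebook n) sz => /(_ i j lti ltj ltij).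
by rewrite /balanced agreement_sym // !szw // mem_nth // sz.
Qed.

Lemma wordE T l : word T l = nth [::] T (l.1.*2 + l.2).
Proof.
rewrite /word -nth0.
have -> k : iter k (fun t : seq (seq bool) => behead (behead t)) =1 drop k.*2.
  elim: k => [t|k IH t]; first by rewrite drop0.
  by rewrite iterSr IH; case: t => [|a [|b t]].
by rewrite nth_drop addn0; case: l => i []; rewrite ?addn1 ?addn0 ?nth_behead.
Qed.

Lemma word_index (l : literal) n : l.1 <= n -> l.1.*2 + l.2 < 2 * n.+1.
Proof. by case: l => i [] /=; lia. Qed.

Lemma size_word n (l : literal) : l.1 <= n -> size (word (codebook n) l) = 7 * rate n.
Proof.
move=> /word_index ltl; have [sz szw _] := codebookP n.
by rewrite wordE szw // mem_nth // sz.
Qed.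

Lemma agreement_word n (l l' : literal) : l.1 <= n -> l'.1 <= n -> l != l' ->
  balanced (rate n) (word (codebook n) l) (word (codebook n) l').
Proof.
move=> /word_index ltl /word_index ltl' neq; have [_ _ bal] := codebookP n.
rewrite !wordE; apply: bal => //; apply: contra neq => /eqP E.
by case: l l' E {ltl ltl'} => [i []] [j []] /= E; apply/eqP; congr pair; lia.
Qed.

(** * Geometry of the instance *)

Local Open Scope ring_scope.

Definition vec d (s : seq rat) : 'rV[rat]_d := \row_i nth 0 s i.

Definition sqdist (s t : seq rat) : rat := \sum_(p <- zip s t) (p.1 - p.2) ^+ 2.

Lemma enc_vec d (s : seq rat) : size s = d -> enc_point (vec d s) = enc_seq enc_rat s.
Proof.
move=> sz; rewrite /enc_point; congr enc_seq; apply: (@eq_from_nth _ 0).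
  by rewrite size_map size_enum_ord.
move=> i; rewrite size_map size_enum_ord => lti.
by rewrite (nth_map (Ordinal lti)) ?size_enum_ord // mxE nth_enum_ord.
Qed.

Lemma edist_vec (R : realType) d (s t : seq rat) : size s = d -> size t = d ->
  edist R (vec d s) (vec d t) = Num.sqrt (ratr (sqdist s t)).
Proof.
move=> ss st; congr Num.sqrt; rewrite /sqdist (big_nth (0, 0)) size_zip ss st minnn.
rewrite big_mkord rmorph_sum; apply: eq_bigr => i _.
by rewrite !mxE nth_zip ?ss ?st // rmorphXn /= rmorphB.
Qed.

Lemma cost_le (R : realType) (I : supplier) (S : seq 'rV[rat]_(sdim I)) (r : R) :
  0 <= r ->
  (forall p, p \in clients I -> exists2 q, q \in S & edist R p q <= r) ->
  (cost R S <= r%:E)%E.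
Proof.
move=> r0; rewrite /cost; elim: (clients I) => [|p C IH] h.
  by rewrite big_nil lee_fin.
rewrite big_cons ge_max IH ?andbT; last first.
  by move=> p' p'C; apply: h; rewrite inE p'C orbT.
have [q qS le_r] := h p (mem_head _ _); elim: S qS {IH h} => // q' S IH.
rewrite inE big_cons ge_min => /orP[/eqP<-|/IH->]; last by rewrite orbT.
by rewrite lee_fin le_r.
Qed.

Lemma cost_lt (R : realType) (I : supplier) (S : seq 'rV[rat]_(sdim I)) (r : R) p :
  (cost R S < r%:E)%E -> p \in clients I -> exists2 q, q \in S & edist R p q < r.
Proof.
rewrite /cost; elim: (clients I) => [//|p' C IH].
rewrite big_cons gt_max inE => /andP[lt1 lt2] /orP[/eqP->|]; last exact: IH.
elim: S lt1 {IH lt2} => [|q S IH]; first by rewrite big_nil.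
rewrite big_cons gt_min lte_fin => /orP[lt_r|/IH[q' q'S lt_r]].
  by exists q; rewrite ?mem_head.
by exists q' => //; rewrite inE q'S orbT.
Qed.

Lemma size_zipd (A B : Type) (b0 : B) (s : seq A) t : size (zipd b0 s t) = size s.
Proof. by elim: s t => //= a s IH t; rewrite IH. Qed.

(* If t of the three words agree with the word of the facility at a coordinate,
   then the points differ by [12 - t] or [t - 12] there.
   Since [(12 - t) ^ 2] is convex, it lies below its chord [144 - 21 t] on
   [0, 3], and at the integers above its chord [142 - 21 t] through 1 and 2. *)
Lemma coord_bounds a b0 b1 b2 :
  let t := ((b0 == a) + (b1 == a) + (b2 == a))%N%:R in
  let x := (client_coord (b0, (b1, b2)) - facility_coord a) ^+ 2 in
  142 - 21 * t <= x /\ x <= 144 - 21 * t.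
Proof.
have eqE (b : bool) : (b == a)%:R = if a then b%:R else 1 - b%:R :> rat.
  by case: a; case: b; rewrite ?subr0 ?subrr.
have b01 (b : bool) : (b%:R = 0 :> rat) \/ (b%:R = 1 :> rat).
  by case: b; [right | left].
rewrite /client_coord /facility_coord !natrD !eqE.
by case: a {eqE}; case: (b01 b0) => ->; case: (b01 b1) => ->; case: (b01 b2) => ->;
  split; lra.
Qed.

Lemma sqdist_cons x y s t :
  sqdist (x :: s) (y :: t) = (x - y) ^+ 2 + sqdist s t.
Proof. by rewrite /sqdist big_cons. Qed.

(** Bounds that are affine in the number of agreeing words at each coordinate, with a common slope,
    add up to bounds in the total agreement. *)
Lemma sqdist_coords (lo hi sl : rat) :
  (forall a b0 b1 b2,
    let t := ((b0 == a) + (b1 == a) + (b2 == a))%N%:R in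
    let x := (client_coord (b0, (b1, b2)) - facility_coord a) ^+ 2 in
    lo - sl * t <= x /\ x <= hi - sl * t) ->
  forall u w0 w1 w2, size w0 = size u -> size w1 = size u -> size w2 = size u ->
  let S := sqdist [seq client_coord q | q <- zipd (false, false) w0 (zipd false w1 w2)]
                  [seq facility_coord b | b <- u] in
  let t := (agreement w0 u + agreement w1 u + agreement w2 u)%N%:R in
  lo * (size u)%:R - sl * t <= S /\ S <= hi * (size u)%:R - sl * t.
Proof.
move=> bd; elim=> [|a u IH] [|b0 w0] [|b1 w1] [|b2 w2] // => [_ _ _|[s0] [s1] [s2]].
  by rewrite [sqdist _ _]big_nil /agreement /= !mulr0 subrr lexx.
have [lo2 hi2] := IH _ _ _ s0 s1 s2; have [lo1 hi1] := bd a b0 b1 b2.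
rewrite [zipd _ _ _]/= !map_cons sqdist_cons !agreement_cons [size (_ :: _)]/=.
move: lo1 hi1 lo2 hi2; rewrite -[(size u).+1]addn1 /= !natrD.
set S := sqdist _ _; set x := (_ - _) ^+ 2.
split; lra.
Qed.

Definition lits n : seq literal :=
  [seq (i, false) | i <- iota 0 n.+1] ++ [seq (i, true) | i <- iota 0 n.+1].

Lemma mem_lits n (l : literal) : (l \in lits n) = (l.1 <= n)%N.
Proof.
rewrite mem_cat; case: l => i b; apply/orP/idP => [|le_i].
  by case=> /mapP[j]; rewrite mem_iota => /andP[_ lt_j] -[-> _]; rewrite -ltnS.
by case: b le_i => le_i; [right | left]; apply: (map_f (fun j => (j, _)));
   rewrite mem_iota.
Qed.

Lemma facility_pointsE n :
  facility_points n = [seq facility_point (codebook n) l | l <- lits n].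
Proof. by rewrite /lits map_cat -!map_comp. Qed.

Lemma size_facility_point n (l : literal) : (l.1 <= n)%N ->
  size (facility_point (codebook n) l) = dimension n.
Proof. by move=> le_l; rewrite /= size_map size_word. Qed.

Lemma marker_inj b b' i i' : marker b i = marker b' i' -> (b, i) = (b', i').
Proof.
move=> /(congr1 enc_rat); rewrite !enc_marker => -[Eb Ei].
have -> : b = b' by case: b b' Eb => [] [].
by congr pair; move: (congr1 Defs.tsize Ei); rewrite !tsize_unary; lia.
Qed.

Lemma marker_bound b i : -2^-1 <= marker b i <= 2^-1.
Proof.
have h0 : (0 : rat) < 2 ^+ i by rewrite exprn_gt0.
have h : (2 ^+ i.+1 : rat)^-1 <= 2^-1.
  by rewrite lef_pV2 ?posrE ?exprn_gt0 // exprS ler_pMr // exprn_ege1.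
have h1 : (0 : rat) <= (2 ^+ i.+1)^-1 by rewrite invr_ge0 exprn_ge0.
by rewrite /marker; case: b; rewrite ?expr1 ?expr0; lra.
Qed.

Lemma vec_inj d (s t : seq rat) : size s = d -> size t = d ->
  vec d s = vec d t -> s = t.
Proof.
move=> ss st /rowP E; apply: (@eq_from_nth _ 0); first by rewrite ss.
by move=> i; rewrite ss => lti; have := E (Ordinal lti); rewrite !mxE.
Qed.

Definition facility n (l : literal) : 'rV[rat]_(dimension n) :=
  vec _ (facility_point (codebook n) l).

Lemma facility_inj n (l l' : literal) : (l.1 <= n)%N -> (l'.1 <= n)%N ->
  facility n l = facility n l' -> l = l'.
Proof.
move=> le_l le_l' /vec_inj E.
have := E (size_facility_point le_l) (size_facility_point le_l').
rewrite /facility_point => -[/marker_inj].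
by case: l l' {le_l le_l' E} => [i b] [j c] [-> ->].
Qed.

Definition wf_clause n (c : seq literal) : bool :=
  (size c == 3) && all (fun l => l.1 <= n)%N c.

(** Beyond the end of the clause, the default literal has index 0, which is admissible even for n =
    0 thanks to the dummy variable. *)
Lemma wf_clause_lit n c i : wf_clause n c -> ((clause_lit c i).1 <= n)%N.
Proof.
move=> /andP[_ /allP h]; rewrite /clause_lit.
have [lt_i|le_i] := ltnP i (size c); first by apply: h; rewrite mem_nth.
by rewrite nth_default.
Qed.

Definition client n (p : nat * seq literal) : 'rV[rat]_(dimension n) :=
  vec _ (client_point (codebook n) p).

Lemma size_client_point n j (c : seq literal) : wf_clause n c ->
  size (client_point (codebook n) (j, c)) = dimension n.
Proof.
move=> wf; rewrite /= size_map size_zipd size_word //.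
exact: (wf_clause_lit 0 wf).
Qed.

Lemma mem_clause3 n (c : seq literal) (l : literal) : wf_clause n c ->
  (l \in c) = [|| l == clause_lit c 0, l == clause_lit c 1 | l == clause_lit c 2].
Proof. by case: c => [|l0 [|l1 [|l2 [|? ?]]]] // _; rewrite !inE. Qed.

Lemma sum3_agreement K (p0 p1 p2 : bool) a0 a1 a2 :
  (if p0 then a0 = 7 * K else is_true (3 * K <= a0 <= 4 * K))%N ->
  (if p1 then a1 = 7 * K else is_true (3 * K <= a1 <= 4 * K))%N ->
  (if p2 then a2 = 7 * K else is_true (3 * K <= a2 <= 4 * K))%N ->
  ([|| p0, p1 | p2] -> (13 * K <= a0 + a1 + a2)%N) /\
  (~~ [|| p0, p1 | p2] -> (a0 + a1 + a2 <= 12 * K)%N).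
Proof. by case: p0; case: p1; case: p2 => /=; lia. Qed.

(** With N = 7 K coordinates, total agreement at least 13 K gives 144 - 21 * 13 / 7 = 105 per
    coordinate, and at most 12 K gives 142 - 21 * 12 / 7 = 106. The summand 1 pays for the
    markers. *)
Lemma sqdist_client_facility n j (c : seq literal) (l : literal) :
  wf_clause n c -> (l.1 <= n)%N ->
  let D := sqdist (client_point (codebook n) (j, c)) (facility_point (codebook n) l) in
  let N := (7 * rate n)%N in
  (l \in c -> D <= 105 * N%:R + 1) /\ (l \notin c -> 106 * N%:R <= D).
Proof.
move=> wf le_l D N; have le_c i := wf_clause_lit i wf.
have DE : D = (marker false j - marker l.2 l.1) ^+ 2 +
   sqdist (behead (client_point (codebook n) (j, c)))
     (behead (facility_point (codebook n) l)).
  by rewrite /D /sqdist /client_point /facility_point /= big_cons.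
have sw k : size (word (codebook n) (clause_lit c k)) = size (word (codebook n) l).
  by rewrite !size_word.
have := sqdist_coords coord_bounds (sw 0%N) (sw 1%N) (sw 2).
move: DE; rewrite /=; set S := sqdist _ _; set t := (_ + _ + _)%N => DE.
rewrite (size_word le_l) -/N => -[lo hi].
have [m0 m1] : 0 <= (marker false j - marker l.2 l.1) ^+ 2 /\
    (marker false j - marker l.2 l.1) ^+ 2 <= 1.
  have := marker_bound false j; have := marker_bound l.2 l.1.
  by split; [exact: sqr_ge0 | nra].
have agr k : if l == clause_lit c k
    then agreement (word (codebook n) (clause_lit c k)) (word (codebook n) l) = N
    else (3 * rate n <= agreement (word (codebook n) (clause_lit c k))
            (word (codebook n) l) <= 4 * rate n)%N.
  case: eqP => [->|/eqP neq]; first by rewrite agreement_refl size_word.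
  by apply: agreement_word; [exact: le_c | exact: le_l | rewrite eq_sym; exact: neq].
rewrite (mem_clause3 l wf); have := agr 0%N; have := agr 1%N; have := agr 2.
rewrite /t in lo hi; move: lo hi.
set a0 := agreement (word _ (clause_lit c 0)) _.
set a1 := agreement (word _ (clause_lit c 1)) _.
set a2 := agreement (word _ (clause_lit c 2)) _ => lo hi h2 h1 h0.
have [le13 le12] := sum3_agreement h0 h1 h2.
split=> mem.
  have : 13 * (rate n)%:R <= (a0 + a1 + a2)%:R :> rat by rewrite -natrM ler_nat le13.
  by move: hi; rewrite DE /N natrM; lra.
have : (a0 + a1 + a2)%:R <= 12 * (rate n)%:R :> rat by rewrite -natrM ler_nat le12.
by move: lo; rewrite DE /N natrM; lra.
Qed.

(** * The instance of a formula and its gap *)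

Definition cnf_view (phi : cnf3) : nat * seq (seq literal) :=
  (nvars phi, [seq [seq (nat_of_ord l.1, l.2) | l <- tval cl] | cl <- clauses phi]).

Lemma wf_clauses_of phi (c : seq literal) :
  c \in clauses_of (cnf_view phi) -> wf_clause (nvars phi) c.
Proof.
rewrite mem_cat => /orP[/mapP[cl _ ->]|/mapP[i + ->]].
  rewrite /wf_clause size_map size_tuple eqxx; apply/allP => _ /mapP[l _ ->] /=.
  exact: ltnW.
by rewrite mem_iota /wf_clause /= => lt_i; rewrite !andbT !andbb -ltnS.
Qed.

Lemma zipdE (A B : Type) (b0 : B) (s : seq A) (t : seq B) :
  size s = size t -> zipd b0 s t = zip s t.
Proof. by elim: s t => [|a s IH] [|b t] //= [/IH->]. Qed.

Lemma client_pointsE x : client_points x =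
  [seq client_point (codebook x.1) p
     | p <- zip (iota 0 (size (clauses_of x))) (clauses_of x)].
Proof. by rewrite /client_points zipdE // size_iota. Qed.

(** The first coordinate alone separates the points, since it names the position in the clause list;
    repeated clauses thus do no harm. *)
Lemma uniq_clients x :
  uniq [seq vec (dimension x.1) s | s <- client_points x].
Proof.
apply: (@map_uniq _ _ (fun v : 'rV[rat]_(dimension x.1) => v 0 ord0)).
rewrite client_pointsE -!map_comp.
rewrite (@eq_map _ _ _ (marker false \o fst)) => [|p /=]; last by rewrite mxE.
rewrite map_comp -/(unzip1 _) unzip1_zip ?size_iota // map_inj_uniq ?iota_uniq //.
by move=> i j /marker_inj [].
Qed.

Lemma uniq_lits n : uniq (lits n).
Proof.
rewrite /lits cat_uniq !map_inj_uniq ?iota_uniq; try by move=> i j [].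
by rewrite andbT; apply/hasPn => _ /mapP[i _ ->]; apply/negP => /mapP[j].
Qed.

Lemma uniq_facilities n : uniq [seq vec (dimension n) s | s <- facility_points n].
Proof.
apply: (@map_uniq _ _ (fun v : 'rV[rat]_(dimension n) => v 0 ord0)).
rewrite facility_pointsE -!map_comp map_inj_uniq ?uniq_lits // => -[i b] [j c] /=.
by rewrite !mxE => /marker_inj [-> ->].
Qed.

Lemma budget_facilities n :
  (0 < n.+1 <= size [seq vec (dimension n) s | s <- facility_points n])%N.
Proof. by rewrite size_map size_cat !size_map size_iota leq_addr. Qed.

Definition instance phi : supplier :=
  Supplier (uniq_clients (cnf_view phi)) (uniq_facilities (nvars phi))
    (budget_facilities (nvars phi)).

Lemma facilitiesE phi :
  facilities (instance phi) = [seq facility (nvars phi) l | l <- lits (nvars phi)].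
Proof.
transitivity [seq vec (dimension (nvars phi)) s | s <- facility_points (nvars phi)] => //.
by rewrite facility_pointsE -map_comp.
Qed.

Lemma clientsE phi : clients (instance phi) =
  [seq client (nvars phi) p
     | p <- zip (iota 0 (size (clauses_of (cnf_view phi)))) (clauses_of (cnf_view phi))].
Proof.
transitivity [seq vec (dimension (nvars phi)) s | s <- client_points (cnf_view phi)].
  by [].
by rewrite client_pointsE -map_comp.
Qed.

Lemma clientsP phi p : p \in clients (instance phi) ->
  exists j c, c \in clauses_of (cnf_view phi) /\ p = client (nvars phi) (j, c).
Proof.
rewrite clientsE => /mapP[[j c] jc ->]; exists j, c; split=> //.
have := map_f snd jc; rewrite -/(unzip2 _) unzip2_zip ?size_iota //.
Qed.

Lemma mem_clients phi (c : seq literal) : c \in clauses_of (cnf_view phi) ->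
  exists j, client (nvars phi) (j, c) \in clients (instance phi).
Proof.
move=> hc; pose m := size (clauses_of (cnf_view phi)).
have : c \in unzip2 (zip (iota 0 m) (clauses_of (cnf_view phi))).
  by rewrite unzip2_zip ?size_iota.
by case/mapP=> -[j c'] jc ->; exists j; rewrite clientsE map_f.
Qed.

Lemma enc_seq_vec d (L : seq (seq rat)) : {in L, forall s, size s = d} ->
  enc_seq (@enc_point d) [seq vec d s | s <- L] = enc_seq (enc_seq enc_rat) L.
Proof.
elim: L => //= s L IH h; rewrite enc_vec ?h ?mem_head // IH // => t tL.
by apply: h; rewrite inE tL orbT.
Qed.

(** Links the program, which works on lists, to row vectors. The length of every list must be
    exactly the dimension, as [vec] would pad or truncate it. *)
Lemma enc_instance phi :
  enc_supplier (instance phi) = cenc (reduction (cnf_view phi)).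
Proof.
have E1 := @enc_seq_vec (dimension (nvars phi)) (client_points (cnf_view phi)).
have E2 := @enc_seq_vec (dimension (nvars phi)) (facility_points (nvars phi)).
rewrite /enc_supplier; congr (Defs.Cons _ (Defs.Cons _ (Defs.Cons _ _))).
  apply: E1 => s; rewrite client_pointsE => /mapP[[j c] jc ->].
  apply: size_client_point; apply: wf_clauses_of.
  by have := map_f snd jc; rewrite -/(unzip2 _) unzip2_zip ?size_iota.
apply: E2 => s; rewrite facility_pointsE => /mapP[l].
by rewrite mem_lits => le_l ->; exact: size_facility_point.
Qed.

Definition radius2 n : rat := 105 * (7 * rate n)%N%:R + 1.
Definition gap2 n : rat := 106 * (7 * rate n)%N%:R.

(** Opening the facilities of the literals true under [a] serves each clause by one of its true
    literals; the tautologies have one under any assignment. *)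
Lemma opt_le (R : realType) phi (a : nat -> bool) :
  all (has (fun l => a l.1 == l.2)) (cnf_view phi).2 ->
  (opt R (instance phi) <= (Num.sqrt (ratr (radius2 (nvars phi))))%:E)%E.
Proof.
set n := nvars phi => sat.
pose S : seq 'rV[rat]_(sdim (instance phi)) :=
  [seq facility n (i, a i) | i <- iota 0 n.+1].
have feas : feasible S.
  split; last by rewrite size_map size_iota.
    rewrite map_inj_in_uniq ?iota_uniq // => i j; rewrite !mem_iota /= !add0n !ltnS.
    by move=> le_i le_j /facility_inj E; have [] := E le_i le_j.
  move=> _ /mapP[i + ->]; rewrite mem_iota ltnS facilitiesE => le_i.
  by apply: map_f; rewrite mem_lits.
apply: (@le_trans _ _ (cost R S)); first by apply: ereal_inf_lbound; exists S.
apply: cost_le; first exact: sqrtr_ge0.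
move=> p /clientsP[j [c [hc ->]]]; have wf := wf_clauses_of hc.
have [l lc al] : exists2 l, l \in c & a l.1 = l.2.
  move: hc; rewrite mem_cat => /orP[/(allP sat)/hasP[l lc /eqP al]|]; first by exists l.
  case/mapP=> i _ ->; case Ea: (a i).
    by exists (i, true) => //; rewrite mem_head.
  by exists (i, false) => //; rewrite /tautology !inE !eqxx !orbT.
have le_l : (l.1 <= n)%N by have /andP[_ /allP h] := wf; exact: h.
exists (facility n l).
  have -> : facility n l = facility n (l.1, a l.1) by rewrite al -surjective_pairing.
  by apply: (map_f (fun i => facility n (i, a i))); rewrite mem_iota.
rewrite edist_vec ?size_facility_point ?size_client_point // ler_wsqrtr // ler_rat.
by have [+ _] := sqdist_client_facility j wf le_l; apply.
Qed.

Lemma rate_ge n : (14 <= rate n)%N.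
Proof. by have := rate_gt0 n; rewrite /rate muln_gt0 => /andP[_]; lia. Qed.

Lemma gap2_gt0 n : 0 < gap2 n.
Proof. by rewrite /gap2 pmulr_rgt0 ltr0n // muln_gt0 rate_gt0. Qed.

(** Within less than the gap of a client there are only facilities of its own literals. *)
Lemma covered_literal (R : realType) phi (S : seq 'rV[rat]_(sdim (instance phi)))
    (c : seq literal) :
  feasible S -> (cost R S < (Num.sqrt (ratr (gap2 (nvars phi))))%:E)%E ->
  c \in clauses_of (cnf_view phi) ->
  exists2 l, l \in c & facility (nvars phi) l \in S.
Proof.
move=> [_ sub _] lt_cost hc; have wf := wf_clauses_of hc.
have [j /(cost_lt lt_cost)[q qS]] := mem_clients hc.
have := sub q qS; rewrite facilitiesE => /mapP[l]; rewrite mem_lits => le_l Eq.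
rewrite Eq edist_vec ?size_facility_point ?size_client_point //.
rewrite ltr_sqrt; last first.
  by rewrite ltr0q gap2_gt0.
rewrite ltr_rat => lt_D; exists l; last by rewrite -Eq.
apply: contraT => nlc; have [_ /(_ nlc)] := sqdist_client_facility j wf le_l.
by move=> /(lt_le_trans lt_D); rewrite ltxx.
Qed.

Lemma ratr_mul_sqrt (R : realType) (q x y : rat) : 0 <= q -> 0 < y ->
  q ^+ 2 * x < y -> ratr q * Num.sqrt (ratr x) < Num.sqrt (ratr y) :> R.
Proof.
move=> q0 y0 lt_y; have -> : ratr q = Num.sqrt (ratr (q ^+ 2)) :> R.
  by rewrite rmorphXn /= sqrtr_sqr ger0_norm // ler0q.
by rewrite -sqrtrM ?ler0q ?sqr_ge0 // -rmorphM /= ltr_sqrt ?ltr0q ?ltr_rat.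
Qed.

Lemma ratr_frac (R : realType) (a b : nat) :
  ratr (a%:R / b%:R) = a%:R / b%:R :> R.
Proof. by rewrite fmorph_div !rmorph_nat. Qed.

(** As N = 7 * rate n is at least 98, the summand 1 is negligible: (1001/1000)^2 * (105 N + 1) < 106
    N. *)
Lemma alpha_gap (R : realType) n :
  1001 / 1000 * Num.sqrt (ratr (radius2 n)) < Num.sqrt (ratr (gap2 n)) :> R.
Proof.
have rg : 14 <= (rate n)%:R :> rat by rewrite ler_nat rate_ge.
rewrite -ratr_frac; apply: ratr_mul_sqrt; [lra | exact: gap2_gt0 |].
rewrite /radius2 /gap2 natrM; lra.
Qed.

(** * Decoding a solution *)

Local Open Scope nat_scope.

(* In the encoding of a facility, the marker coordinate exhibits the truth
   value of its literal as a sign and the index of its variable in unary. *)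
Definition names_true i (t : tree) : bool :=
  let u := ttl (ttl (ttl (thd t))) in
  truthy (thd (thd (thd t))) && (truthy (iter i ttl u) && ~~ truthy (iter i.+1 ttl u)).

(** Only the first [k] entries of the list are inspected, whatever the size of [y]; a variable not
    named among them is set to false. *)
Definition decoded k (y : tree) i : bool :=
  (iter k (fun st : bool * tree => (names_true i (thd st.2) || st.1, ttl st.2))
    (false, y)).1.

Definition verdict (phi : cnf3) (y : tree) : bool :=
  all (fun c : seq literal => has (fun l => decoded (nvars phi).+1 y l.1 == l.2) c)
    (cnf_view phi).2.

(** * Polynomial time of the verdict *)

Lemma ptime_thd (X : ctype) (y : X -> tree) : ptime y -> ptime (fun x => thd (y x)).
Proof.
apply: (ptime_comp (g := thd)); apply: (ptime_expr (e := EHd (EVar 0))).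
  by move=> t s /= ->.
exact: pbnd_const.
Qed.

Lemma ptime_ttl (X : ctype) (y : X -> tree) : ptime y -> ptime (fun x => ttl (y x)).
Proof.
apply: (ptime_comp (g := ttl)); apply: (ptime_expr (e := ETl (EVar 0))).
  by move=> t s /= ->.
exact: pbnd_const.
Qed.

Lemma ptime_is_cons (X : ctype) (y : X -> tree) :
  ptime y -> ptime (fun x => truthy (y x)).
Proof. exact: ptime_truthy. Qed.

Lemma ptime_iter_ttl (X : ctype) (i : X -> nat) (y : X -> tree) :
  ptime i -> ptime y -> ptime (fun x => iter (i x) ttl (y x)).
Proof.
move=> hi hy; apply: (ptime_iter (F := fun=> ttl)) => //.
  by apply: ptime_ttl; ptime_proj.
by exists (fun=> 0) => //; exact: pbnd_const.
Qed.

Lemma ptime_names_true (X : ctype) (i : X -> nat) (y : X -> tree) :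
  ptime i -> ptime y -> ptime (fun x => names_true (i x) (y x)).
Proof.
move=> hi hy.
have hu : ptime (fun x => ttl (ttl (ttl (thd (y x))))).
  by do 3 apply: ptime_ttl; apply: ptime_thd.
apply: ptime_andb; first by apply: ptime_is_cons; do 3 apply: ptime_thd.
apply: ptime_andb; first by apply: ptime_is_cons; apply: ptime_iter_ttl.
apply: ptime_negb; apply: ptime_is_cons; apply: ptime_iter_ttl => //.
exact: ptime_succ.
Qed.

Lemma ptime_decoded (X : ctype) (k i : X -> nat) (y : X -> tree) :
  ptime k -> ptime y -> ptime i -> ptime (fun x => decoded (k x) (y x) (i x)).
Proof.
move=> hk hy hi; apply: ptime_fst.
apply: (ptime_iter
  (F := fun x (st : bool * tree) => (names_true (i x) (thd st.2) || st.1, ttl st.2))).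
- apply: ptime_pair; last by apply: ptime_ttl; ptime_proj.
  apply: ptime_orb; last by ptime_proj.
  apply: ptime_names_true; last by apply: ptime_thd; ptime_proj.
  by apply: (ptime_comp (g := i)) => //; ptime_proj.
- by apply: ptime_pair => //; apply: ptime_const.
- by [].
exists (fun=> 4); first exact: pbnd_const.
by move=> x j _; case: (iter _ _ _) => -[] t.
Qed.

Lemma csz_seq_tsize (X : ctype) (s : seq X) :
  (forall x : X, csz x = Defs.tsize (cenc x)) -> csz s = Defs.tsize (cenc s).
Proof. by move=> h; elim: s => //= x s IH; rewrite h; congr _.+1; rewrite -IH. Qed.

Lemma csz_literal (l : literal) : csz l = Defs.tsize (cenc l).
Proof. by rewrite /= tsize_unary; case: l => i []. Qed.

Lemma enc_cnf_view phi : cenc (cnf_view phi) = enc_cnf3 phi.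
Proof.
rewrite /enc_cnf3; congr Defs.Cons; rewrite /=.
elim: (clauses phi) => //= cl cls ->; congr Defs.Cons.
by elim: (tval cl) => //= l s ->.
Qed.

Lemma csz_cnf_view phi : csz (cnf_view phi) = csz phi.
Proof.
have -> : csz phi = Defs.tsize (enc_cnf3 phi) by [].
rewrite -enc_cnf_view; congr (_ + _).+1; first exact: esym (tsize_unary _).
by apply: csz_seq_tsize => c; apply: csz_seq_tsize; exact: csz_literal.
Qed.

Lemma ptime_cnf_view (X : ctype) (f : X -> cnf3) :
  ptime f -> ptime (fun x => cnf_view (f x)).
Proof.
apply: ptime_cast; first exact: enc_cnf_view.
by move=> phi; rewrite csz_cnf_view.
Qed.

(** Since raw trees have size 0, the time bound depends on the formula alone and holds for every
    tree output by the approximation algorithm. *)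
Lemma ptime_verdict : ptime (fun p : cnf3 * tree => verdict p.1 p.2).
Proof.
pose k (p : cnf3 * tree) := (cnf_view p.1).1.
have hk : ptime k by apply: ptime_fst; apply: ptime_cnf_view; ptime_proj.
apply: (ptime_all (P := fun p (c : seq literal) =>
  has (fun l => decoded (k p).+1 p.2 l.1 == l.2) c)); last first.
  by apply: ptime_snd; apply: ptime_cnf_view; ptime_proj.
apply: (ptime_has (P := fun (q : cnf3 * tree * seq literal) (l : literal) =>
  decoded (k q.1).+1 q.1.2 l.1 == l.2)); last by ptime_proj.
apply: ptime_eqb; last by ptime_proj.
apply: ptime_decoded; try by ptime_proj.
apply: ptime_succ; apply: (ptime_comp (g := k)) => //; ptime_proj.
Qed.

(** * Correctness of the verdict *)

Lemma iter_ttl_unary i m : iter i ttl (enc_unary m) = enc_unary (m - i).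
Proof.
elim: i m => [|i IH] m; first by rewrite subn0.
by rewrite iterS IH subnS; case: (m - i).
Qed.

Lemma truthy_unary m : truthy (enc_unary m) = (0 < m).
Proof. by case: m. Qed.

Lemma names_true_facility n i (l : literal) : l.1 <= n ->
  names_true i (enc_point (facility n l)) = l.2 && (l.1 == i).
Proof.
move=> le_l; rewrite enc_vec ?size_facility_point // /names_true.
have -> : thd (enc_seq enc_rat (facility_point (codebook n) l)) =
    enc_rat (marker l.2 l.1) by [].
rewrite enc_marker; congr andb; first by case: (l.2).
have -> T : ttl (ttl (ttl (Defs.Cons T (Defs.Cons Leaf
    (Defs.Cons Leaf (enc_unary l.1.+1)))))) = enc_unary l.1.+1 by [].
by rewrite !iter_ttl_unary !truthy_unary !subn_gt0; lia.
Qed.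

Lemma decoded_enc_seq d (S : seq 'rV[rat]_d) i :
  decoded (size S) (enc_seq (@enc_point d) S) i = has (names_true i \o @enc_point d) S.
Proof.
rewrite /decoded; rewrite -[RHS]orbF; move: false.
elim: S => // v S IH b; rewrite [size _]/= iterSr IH /=.
by rewrite orbA [has _ _ || _]orbC.
Qed.

(** No assumption is made on [y]: an unsatisfiable formula is rejected in every run, so errors occur
    on satisfiable formulas only. *)
Lemma verdict_sound phi y : verdict phi y -> satisfiable phi.
Proof.
move=> h; apply/existsP; exists [ffun i : 'I_(nvars phi) => decoded (nvars phi).+1 y i].
apply/allP => cl hcl; have := allP h [seq (nat_of_ord l.1, l.2) | l <- tval cl].
case/(_ (map_f _ hcl))/hasP => _ /mapP[l hl ->] /= e.
by apply/hasP; exists l => //; rewrite ffunE.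
Qed.

Lemma satisfiable_view phi : satisfiable phi -> exists a : nat -> bool,
  all (has (fun l => a l.1 == l.2)) (cnf_view phi).2.
Proof.
case/existsP=> a /allP h; exists (fun i => if insub i is Some j then a j else false).
apply/allP => _ /mapP[cl hcl ->]; have /hasP[l hl e] := h cl hcl.
apply/hasP; exists (nat_of_ord l.1, l.2); last by rewrite /= valK.
by apply: map_f.
Qed.

Lemma verdict_complete (R : realType) phi y :
  satisfiable phi -> approx_solution (1001 / 1000 : R)%R (instance phi) y ->
  verdict phi y.
Proof.
set n := nvars phi => /satisfiable_view[a sat] [S [-> feas le_cost]].
have {le_cost}lt_cost : (cost R S < (Num.sqrt (ratr (gap2 n)))%:E)%E.
  apply: le_lt_trans le_cost _.
  apply: (@le_lt_trans _ _ ((1001 / 1000)%:E * (Num.sqrt (ratr (radius2 n)))%:E)%E).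
    apply: lee_wpmul2l (opt_le R sat).
    rewrite lee_fin; lra.
  by rewrite -EFinM lte_fin; exact: alpha_gap.
pose V : seq 'rV[rat]_(sdim (instance phi)) := S.
have cov c := covered_literal (c := c) feas lt_cost.
have [uS sub szS] := feas.
pose b i := facility n (i, true) \in V.
have hb i : i <= n -> facility n (i, b i) \in V.
  move=> le_i; case Eb: (b i); first exact: Eb.
  (* If the positive literal is not open, the client of the tautology forces the negative one to
     be. *)
  have [|l] := cov (tautology i).
    by rewrite mem_cat; apply/orP; right; apply: map_f; rewrite mem_iota.
  by rewrite /tautology !inE => /or3P[] /eqP-> //; rewrite -/V -/(b i) Eb.
pose W := [seq facility n (i, b i) | i <- iota 0 n.+1].
have uW : uniq W.
  rewrite map_inj_in_uniq ?iota_uniq // => i j; rewrite !mem_iota !add0n !ltnS.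
  by move=> le_i le_j /facility_inj E; have [] := E le_i le_j.
have WV : {subset W <= V}.
  by move=> _ /mapP[i + ->]; rewrite mem_iota ltnS => le_i; exact: hb.
(* Both lists are duplicate-free of length n + 1, so the inclusion is an equality: no variable has
   both of its facilities open. *)
have [_ WE] : (size W = size V) * (W =i V).
  by apply: uniq_min_size => //; rewrite size_map size_iota szS.
have memS (l : literal) : l.1 <= n -> (facility n l \in V) = (l.2 == b l.1).
  move=> le_l; rewrite -WE; apply/mapP/eqP.
    case=> i; rewrite mem_iota ltnS => le_i /facility_inj E.
    by rewrite (E le_l le_i).
  move=> El; exists l.1; first by rewrite mem_iota.
  by rewrite -El -surjective_pairing.
have dec i : i <= n -> decoded n.+1 (enc_seq (@enc_point _) S) i = b i.
  move=> le_i; have -> : n.+1 = size S by rewrite szS.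
  rewrite decoded_enc_seq; apply/hasP/idP => [[v vS]|bi].
    have := sub v vS; rewrite facilitiesE => /mapP[l]; rewrite mem_lits => le_l Ev.
    rewrite /= Ev names_true_facility // => /andP[l2 /eqP l1].
    by rewrite /b -l1 -l2 -surjective_pairing -Ev.
  exists (facility n (i, true)) => //=.
  by rewrite names_true_facility // eqxx.
apply/allP => c hc; have hc' : c \in clauses_of (cnf_view phi) by rewrite mem_cat hc.
have [l lc lS] := cov c hc'; apply/hasP; exists l => //.
have le_l : l.1 <= n by have /andP[_ /allP h] := wf_clauses_of hc'; exact: h.
by rewrite dec // eq_sym -memS.
Qed.

(** * Running times *)

Local Open Scope ring_scope.

(** [B] is the value of m at which m^(delta/2) reaches 16 / c. Beyond it the factor 16 is at most c
    m^(delta/2); up to it, m^(1-delta/2) <= m <= B. *)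
Lemma powR_tradeoff (R : realType) (c delta m : R) : 0 < c -> 0 < delta -> delta < 1 ->
  1 <= m -> 16 * m `^ (1 - delta / 2) <= c * m + 16 * (16 / c) `^ (2 / delta).
Proof.
move=> c0 d0 d1 m1; set B := (16 / c) `^ (2 / delta).
have m0 : 0 < m by exact: lt_le_trans ltr01 m1.
have B0 : 0 <= B by exact: powR_ge0.
have [le_mB|lt_Bm] := leP m B.
  have le1 : m `^ (1 - delta / 2) <= m.
    by rewrite -[leRHS]powRr1 ?(ltW m0) // ler_powR //; lra.
  have := mulr_gt0 c0 m0; lra.
have le2 : 16 / c <= m `^ (delta / 2).
  have -> : 16 / c = B `^ (delta / 2).
    have E1 : 2 / delta * (delta / 2) = 1 by field; rewrite gt_eqF.
    by rewrite /B -powRrM E1 powRr1 // divr_ge0 // ltW.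
  apply: ge0_ler_powR; rewrite ?nnegrE ?divr_ge0 ?(ltW d0) ?(ltW m0) ?(ltW lt_Bm) //.
have E : m `^ (1 - delta / 2) * m `^ (delta / 2) = m.
  rewrite -powRD ?subrK ?powRr1 ?(ltW m0) //.
  by apply/implyP => _; rewrite gt_eqF.
have p0 := powR_ge0 m (1 - delta / 2).
have : 16 * m `^ (1 - delta / 2) <= c * m.
  rewrite -{2}E mulrCA mulrC ler_wpM2l //.
  by rewrite -ler_pdivrMl // mulrC.
lra.
Qed.

(** The dimension is 98 L + 1 with 2^L <= 8 (n + 1), and 196 = 2 * 98; so the first factor is at
    most 2 * (8 (n + 1))^(delta/2) <= 16 (n + 1)^(delta/2). *)
Lemma exponent_bound (R : realType) (c delta : R) : 0 < c -> 0 < delta < 1 ->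
  exists C0 : R, forall n : nat,
    2 `^ (196^-1 * delta * (dimension n)%:R) * n.+1%:R `^ (1 - delta)
      <= c * n%:R + C0.
Proof.
move=> c0 /andP[d0 d1]; exists (c + 16 * (16 / c) `^ (2 / delta)) => n.
set m : R := n.+1%:R; have m1 : 1 <= m by rewrite ler1n.
have m0 : 0 < m by exact: lt_le_trans ltr01 m1.
apply: (@le_trans _ _ (16 * m `^ (1 - delta / 2))); last first.
  by have := powR_tradeoff c0 d0 d1 m1; rewrite /m -natr1; lra.
have -> : m `^ (1 - delta / 2) = m `^ (delta / 2) * m `^ (1 - delta).
  rewrite -powRD; last by apply/implyP => _; rewrite gt_eqF.
  by congr (_ `^ _); lra.
rewrite mulrA ler_wpM2r ?powR_ge0 //.
pose L := log_above (4 * n.+1).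
have -> : 196^-1 * delta * (dimension n)%:R = 196^-1 * delta + L%:R * (delta / 2).
  have -> : dimension n = (1 + 98 * L)%N by rewrite /dimension /rate mulnA add1n.
  by rewrite natrD natrM; lra.
rewrite powRD; last by apply/implyP => _; rewrite pnatr_eq0.
have le2 : 2 `^ (196^-1 * delta) <= 2.
  by rewrite -[leRHS]powRr1 // ler_powR ?ler1n //; lra.
have le8 : 2 `^ (L%:R * (delta / 2)) <= (8 * m) `^ (delta / 2).
  rewrite powRrM powR_mulrn //; apply: ge0_ler_powR.
  - by rewrite divr_ge0 // ltW.
  - by rewrite nnegrE exprn_ge0.
  - by rewrite nnegrE mulr_ge0 // ltW.
  have /andP[_ /ltnW] := log_aboveP (isT : (0 < 4 * n.+1)%N).
  by rewrite mulnA -(ler_nat R) natrX natrM.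
have le8m : (8 * m) `^ (delta / 2) <= 8 * m `^ (delta / 2).
  rewrite powRM ?(ltW m0) // ler_wpM2r ?powR_ge0 //.
  by rewrite -[leRHS]powRr1 // ler_powR ?ler1n //; lra.
have := powR_ge0 2 (196^-1 * delta); have := powR_ge0 2 (L%:R * (delta / 2)).
have := powR_ge0 m (delta / 2); nra.
Qed.

(** * The 3-SAT algorithm *)

Local Open Scope nat_scope.

Fixpoint expr_bound (e : expr) : nat :=
  match e with
  | ELeaf => 0
  | EVar x => x.+1
  | ECons e1 e2 => maxn (expr_bound e1) (expr_bound e2)
  | EHd e1 | ETl e1 => expr_bound e1
  end.

Fixpoint cmd_bound (c : cmd) : nat :=
  match c with
  | CSkip => 0
  | CAssign x e => maxn x.+1 (expr_bound e)
  | CFlip x => x.+1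
  | CSeq c1 c2 => maxn (cmd_bound c1) (cmd_bound c2)
  | CIf e c1 c2 => maxn (expr_bound e) (maxn (cmd_bound c1) (cmd_bound c2))
  | CWhile e c => maxn (expr_bound e) (cmd_bound c)
  end.

Definition same_below N (s s' : store) := forall i, i < N -> s' i = s i.

Lemma eval_below N e s s' :
  expr_bound e <= N -> same_below N s s' -> Defs.eval s' e = Defs.eval s e.
Proof.
move=> le_e h; elim: e le_e => [|x|e1 IH1 e2 IH2|e IH|e IH] //=.
- exact: h.
- by rewrite geq_max => /andP[/IH1-> /IH2->].
- by move/IH->.
- by move/IH->.
Qed.

Lemma same_below_upd N s s' x t :
  same_below N s s' -> same_below N (upd s x t) (upd s' x t).
Proof. by move=> h i lt_i; rewrite /upd; case: eqP => // _; exact: h. Qed.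

(** For running an arbitrary program as a subroutine: variables that it does not mention may hold
    anything and are preserved, and surplus tosses stay unread. *)
Lemma exec_frame N c s w s' w' t : exec c s w s' w' t -> cmd_bound c <= N ->
  forall s2 v, same_below N s s2 -> exists s2',
    [/\ exec c s2 (w ++ v) s2' (w' ++ v) t, same_below N s' s2' & same_from N s2 s2'].
Proof.
elim => {c s w s' w' t}.
- by move=> s w _ s2 v h; exists s2; split=> //; exact: XSkip.
- move=> x e s w; rewrite geq_max => /andP[lt_x le_e] s2 v h.
  exists (upd s2 x (Defs.eval s2 e)); split; first exact: XAssign.
    by rewrite (eval_below le_e h); exact: same_below_upd.
  exact: same_from_upd.
- move=> x b s w /= lt_x s2 v h; exists (upd s2 x (enc_bool b)); split.
  + exact: XFlip.
  + exact: same_below_upd.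
  + exact: same_from_upd.
- move=> c1 c2 s w s1 w1 t1 s' w' t2 _ IH1 _ IH2; rewrite geq_max => /andP[b1 b2] s2 v h.
  have [r1 [e1 h1 f1]] := IH1 b1 s2 v h; have [r2 [e2 h2 f2]] := IH2 b2 r1 v h1.
  exists r2; split=> //; first exact: XSeq e1 e2.
  exact: same_from_trans f1 f2.
- move=> e c1 c2 s w s' w' t tr _ IH; rewrite !geq_max => /and3P[be b1 b2] s2 v h.
  have [r [e1 h1 f1]] := IH b1 s2 v h; exists r; split=> //.
  by apply: XIfT => //; rewrite (eval_below be h).
- move=> e c1 c2 s w s' w' t tr _ IH; rewrite !geq_max => /and3P[be b1 b2] s2 v h.
  have [r [e1 h1 f1]] := IH b2 s2 v h; exists r; split=> //.
  by apply: XIfF => //; rewrite (eval_below be h).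
- move=> e c s w tr; rewrite geq_max => /andP[be bc] s2 v h; exists s2; split=> //.
  by apply: XWhileF; rewrite (eval_below be h).
- move=> e c s w s1 w1 t1 s' w' t2 tr _ IH1 _ IH2 b s2 v h.
  have /andP[be bc] : (expr_bound e <= N) && (cmd_bound c <= N) by rewrite -geq_max.
  have [r1 [e1 h1 f1]] := IH1 bc s2 v h; have [r2 [e2 h2 f2]] := IH2 b r1 v h1.
  exists r2; split=> //; last exact: same_from_trans f1 f2.
  by apply: XWhileT e1 e2; rewrite (eval_below be h).
Qed.

(** The approximation algorithm expects leaves in all variables but 0, whereas the reduction leaves
    garbage there. *)
Fixpoint clear_vars n : cmd :=
  if n is n'.+1 then CSeq (clear_vars n') (CAssign n ELeaf) else CSkip.

Lemma reaches_clear_vars n s w : reaches (clear_vars n) s w n.+1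
  (fun s' => forall i, s' i = if 0 < i <= n then Leaf else s i).
Proof.
elim: n => [|n IH] /=.
  exists s, 1; split=> //; first exact: XSkip.
  by case.
rewrite -[n.+2]addn1; apply: reaches_seq IH _ => s1 h1; apply: reaches_assign => i.
rewrite /upd; case: eqP => [->|/eqP neq]; first by rewrite leqnn.
by rewrite h1 [i <= n.+1]leq_eqVlt ltnS (negPf neq).
Qed.

Lemma same_below_init N x s :
  s 0 = x -> (forall i, 0 < i -> i < N -> s i = Leaf) -> same_below N (init x) s.
Proof. by move=> s0 h [|i] lt_i; [exact: s0 | exact: h]. Qed.

(** Stated for each run and each output [y], so that it yields both halting for all tosses and the
    success probability. [Q] is the time of reduction, clearing and verdict; [v] are surplus
    tosses. *)
Lemma sat_via_supplier A : exists P (Q : cnf3 -> nat), pbnd csz Q /\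
  forall phi w y T v, outputs A (enc_supplier (instance phi)) w T y ->
    outputs P (enc_cnf3 phi) (w ++ v) (T + Q phi) (enc_bool (verdict phi y)).
Proof.
have [cr [Nr [Tr [bTr _ hr]]]] : ptime (fun phi => reduction (cnf_view phi)).
  by apply: ptime_reduction; apply: ptime_cnf_view; exact: ptime_id.
have [cv [Nv [Tv [[kv bTv] _ hv]]]] := ptime_verdict.
(* Variable [N] keeps the formula for the verdict, out of reach of the reduction and of [A]. *)
pose N := (maxn Nr (cmd_bound A)).+1.
have leA : cmd_bound A <= N by rewrite leqW // leq_maxr.
have leR : Nr <= N by rewrite leqW // leq_maxl.
pose pre := CSeq (CAssign N (EVar 0)) (CSeq cr (clear_vars N.-1)).
exists (CSeq pre (CSeq A (CSeq (CAssign 0 (ECons (EVar N) (EVar 0))) cv))).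
exists (fun phi => Tr phi + (csz phi + 3) ^ kv + (N + 2)); split.
  by do !apply: pbnd_add => //; try exact: pbnd_const; apply: pbnd_expr; pbnd_sum.
move=> phi w y T v [s [w' [t [eA le_t sy]]]].
have [s1 [t1 [e1 le1 [s10 s1N s1i]]]] : reaches pre (init (enc_cnf3 phi)) (w ++ v)
    (1 + (Tr phi + N)) (fun s1 => [/\ s1 0 = enc_supplier (instance phi),
      s1 N = enc_cnf3 phi & forall i, 0 < i -> i < N -> s1 i = Leaf]).
  apply: (reaches_seq (Q1 := fun s1 => s1 = upd (init (enc_cnf3 phi)) N (enc_cnf3 phi))).
    exact: reaches_assign.
  move=> _ ->; apply: reaches_seq (hr phi _ _ _) _; first by rewrite upd_neq.
  move=> s2 [s20 f2]; apply: reaches_weaken (reaches_clear_vars _ _ _) (leqnn _) _.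
  move=> s3 h3; split.
  - by rewrite h3 s20 enc_instance.
  - by rewrite h3 /= ltnn f2 // upd_eq.
  - by move=> i i0 lt_i; rewrite h3 i0 -ltnS prednK ?lt_i.
have [s2 [e2 b2 f2]] := exec_frame eA leA v (same_below_init s10 s1i).
have [s3 [t3 [e3 le3 [s30 _]]]] : reaches
    (CSeq (CAssign 0 (ECons (EVar N) (EVar 0))) cv) s2 (w' ++ v) (1 + Tv (phi, y))
    (fun s3 => s3 0 = enc_bool (verdict phi y) /\ True).
  apply: (reaches_seq (Q1 := fun s3 => s3 0 = cenc (phi, y))).
    by apply: reaches_assign; rewrite upd_eq /= f2 // s1N b2 // sy.
  move=> s3 s30; apply: reaches_weaken (hv (phi, y) s3 _ s30) (leqnn _) _.
  by move=> s4 [-> _].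
exists s3, (w' ++ v), (t1 + (t + t3)); split=> //.
  by apply: XSeq e1 _; apply: XSeq e2 e3.
have : Tv (phi, y) <= (csz phi + 3) ^ kv.
  by apply: leq_trans (bTv _) _; rewrite csz_pairE addn0 addSn -addnS.
by move: le1 le3 le_t; lia.
Qed.

Lemma pbnd_horner (p : {poly nat}) : pbnd id (fun m => p.[m]%R).
Proof.
elim/poly_ind: p => [|p c IH].
  by exists 0 => m; rewrite horner0.
apply: (@pbnd_le _ _ _ (fun m => p.[m]%R * m + c)) => [m|].
  by rewrite hornerMXaddC.
by pbnd_sum.
Qed.

Local Open Scope ring_scope.

(** Each good toss sequence has 2^Q extensions, all of them good, and the number of all sequences
    grows by the same factor. *)
Lemma prob_transfer (R : realType) A P x x' T Q (good good' : tree -> Prop) :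
  (forall (w : T.-tuple bool) (v : Q.-tuple bool) y, outputs A x w T y -> good y ->
    exists2 y', outputs P x' (w ++ v) (T + Q) y' & good' y') ->
  prob R A x T good <= prob R P x' (T + Q) good'.
Proof.
move=> h; rewrite /prob ler_pdivrMr ?exprn_gt0 // mulrAC ler_pdivlMr ?exprn_gt0 //.
set GA := [set w : T.-tuple bool | _]; set GP := [set w : (T + Q).-tuple bool | _].
suff le_card : (#|GA| * 2 ^ Q <= #|GP|)%N.
  rewrite exprD [2 ^+ T * _]mulrC mulrA ler_wpM2r ?exprn_ge0 //.
  by rewrite -natrX -natrM ler_nat.
pose f (p : T.-tuple bool * Q.-tuple bool) := cat_tuple p.1 p.2.
have finj : injective f.
  move=> [w v] [w' v'] /(congr1 val) /= /eqP; rewrite eqseq_cat ?size_tuple //.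
  by move=> /andP[/eqP/val_inj-> /eqP/val_inj->].
have -> : (#|GA| * 2 ^ Q = #|f @: finset.setX GA [set: Q.-tuple bool]|)%N.
  by rewrite card_imset // cardsX cardsT card_tuple card_bool.
apply/subset_leq_card/fintype.subsetP => _ /imsetP[[w v] + ->].
rewrite !inE /= => /andP[/asboolP[y out gy] _].
by apply/asboolP/asboolT; exact: (h w v y out gy).
Qed.

(** No raw tree occurs in the instance, so [csz] is its true size, to which the polynomial of the
    approximation algorithm applies. *)
Lemma tsize_instance phi :
  Defs.tsize (enc_supplier (instance phi)) = csz (reduction (cnf_view phi)).
Proof.
have pairE (X Y : ctype) (x : X) (y : Y) : csz x = Defs.tsize (cenc x) ->
    csz y = Defs.tsize (cenc y) -> csz (x, y) = Defs.tsize (cenc (x, y)).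
  by move=> ex ey; rewrite csz_pairE ex ey.
have natE (n : nat) : csz n = Defs.tsize (cenc n) by rewrite [RHS]tsize_unary.
have pointsE (L : seq (seq rat)) : csz L = Defs.tsize (cenc L).
  by apply: csz_seq_tsize => s; apply: csz_seq_tsize.
rewrite enc_instance /reduction; apply/esym; apply: (pairE); first exact: natE.
by apply: (pairE); [exact: pointsE | apply: (pairE); [exact: pointsE | exact: natE]].
Qed.

Theorem theorem3 (R : realType) :
  rETH R ->
  exists eps alpha : R, [/\ 0 < eps, 1 < alpha &
    forall delta : R, 0 < delta < 1 ->
      ~ exists A : cmd,
          solves enc_supplier (approx_solution alpha)
            (fun I => 2 `^ (2 `^ (eps * delta * (sdim I)%:R)
                            * (budget I)%:R `^ (1 - delta))) A].
Proof.
(* The values are those of [exponent_bound] and [alpha_gap]. *)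
move=> [c [c0 noA]]; exists 196^-1, (1001 / 1000); split; [lra | lra |].
move=> delta hdelta [A [p hA]]; apply: noA.
have [P [Q [bQ hP]]] := sat_via_supplier A.
have [C0 hC0] := exponent_bound c0 hdelta.
(* A natural number above the constant factor 2^C0, which is thereby moved into the polynomial. *)
pose j := Num.bound (2 `^ C0 : R).
pose G phi := (p.[Defs.tsize (enc_supplier (instance phi))] * j + Q phi)%N.
have [k hk] : pbnd (fun phi : cnf3 => Defs.tsize (enc_cnf3 phi)) G.
  apply: pbnd_add => //; apply: pbnd_mul; last exact: pbnd_const.
  apply: (@pbnd_trans _ _ (fun phi => csz (reduction (cnf_view phi)))).
    by apply: ptime_size; apply: ptime_reduction; apply: ptime_cnf_view; exact: ptime_id.
  apply: (@pbnd_le _ _ _ (fun phi => p.[csz (reduction (cnf_view phi))])) => [phi|].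
    by rewrite tsize_instance.
  exact: (pbnd_comp (m := id) (fun phi => csz (reduction (cnf_view phi)))
    (pbnd_horner p)).
exists P, (('X + 2%:P) ^+ k) => phi.
have [T [leT haltA probA]] := hA (instance phi).
exists (T + Q phi)%N; split.
- set E : R := 2 `^ (c * (nvars phi)%:R).
  have E1 : 1 <= E by rewrite /E -[leLHS](powRr0 2) ler_powR ?ler1n // mulr_ge0 // ltW.
  apply: (@le_trans _ _ ((G phi)%:R * E)); last first.
    rewrite ler_wpM2r ?(le_trans ler01) // ler_nat.
    by rewrite horner_exp hornerD hornerX hornerC; exact: hk.
  rewrite /G !natrD natrM mulrDl lerD //; last by rewrite ler_peMr.
  apply: le_trans leT _; rewrite -[leRHS]mulrA ler_wpM2l //.
  apply: (@le_trans _ _ (2 `^ (c * (nvars phi)%:R + C0))).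
    by rewrite ler_powR ?ler1n //; exact: hC0.
  rewrite powRD; last by apply/implyP => _; rewrite pnatr_eq0.
  rewrite -/E mulrC ler_wpM2r ?(le_trans ler01) //.
  by rewrite ltW // archi_boundP // powR_ge0.
(* The approximation algorithm reads at most the first [T] tosses; the rest are surplus. *)
- move=> w; have sz : size (take T w) == T by rewrite size_take_min size_tuple; lia.
  have [y out] := haltA (Tuple sz).
  exists (enc_bool (verdict phi y)); rewrite -(cat_take_drop T w).
  exact: hP out.
apply: le_trans probA _; apply: prob_transfer => w v y out gy.
exists (enc_bool (verdict phi y)); first exact: hP out.
rewrite /decides_sat; have -> : truthy (enc_bool (verdict phi y)) = verdict phi y.
  by case: (verdict phi y).
apply/idP/idP => [/verdict_sound //|sat]; exact: verdict_complete sat gy.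
Qed.
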